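(* Let $\mathbb{F}$ be an arbitrary field and let $d, D, \Delta, s$ be positive integers. Let $\mathcal{P}$ be a set of $m$ points in $\mathbb{F}^D$ and let $\mathcal{V}$ be a set of $n$ varieties in $\mathbb{F}^D$, each of dimension $d$ and degree at most $\Delta$. If the incidence graph $G(\mathcal{P},\mathcal{V})$ contains no copy of $K_{s,s}$, then \[ I(\mathcal{P},\mathcal{V}) \le C\,\big(m^{\frac{d}{d+1}}\, n + m\big), \] where $C$ is a constant depending only on $d$, $\Delta$ and $s$ (in particular not on $D$, $\mathbb{F}$, $m$ or $n$).
   Context: Let $\overline{\mathbb{F}}$ be the algebraic closure of $\mathbb{F}$. An affine algebraic set is the common zero set in $\overline{\mathbb{F}}^D$ of finitely many polynomials in $\overline{\mathbb{F}}[x_1,\dots,x_D]$; a variety is an irreducible algebraic set (not a union of two proper algebraic subsets). Dimension and degree of a variety are the usual ones (the degree of the Hilbert polynomial of the ideal of its projective closure, and $(\dim)!$ times its leading coefficient). A point $x\in\mathcal{P}$ is incident to $V\in\mathcal{V}$ if $x\in V$. The incidence graph $G(\mathcal{P},\mathcal{V})$ is the bipartite graph with parts $\mathcal{P}$ and $\mathcal{V}$ in which $x$ and $V$ are adjacent iff $x\in V$; $I(\mathcal{P},\mathcal{V})$ is its number of edges. *)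

(* Defs.v *)
From mathcomp Require Import all_boot all_order all_algebra finmap.
From mathcomp Require Import boolp classical_sets reals exp.
From mathcomp Require Import mpoly.

Set Implicit Arguments.
Unset Strict Implicit.
Unset Printing Implicit Defensive.

Import Order.TTheory GRing.Theory Num.Theory.

Local Open Scope ring_scope.
Local Open Scope classical_set_scope.

Definition is_algebraic_closure (F : fieldType) (K : closedFieldType)
    (iota : {rmorphism F -> K}) : Prop :=
  forall x : K, algebraicOver iota x.

Section AffineVarieties.
Variable K : fieldType.

Definition peval n (f : {mpoly K[n]}) (v : 'rV[K]_n) : K := f.@[v ord0].

Definition affine_algebraic_set D (Z : set 'rV[K]_D) : Prop :=
  exists s : seq {mpoly K[D]},
    Z = [set v | forall f, f \in s -> peval f v = 0].

(* The empty set satisfies this definition, but it has Hilbert polynomial 0,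
   hence no positive dimension in the sense of variety_dim below. *)
Definition affine_variety D (Z : set 'rV[K]_D) : Prop :=
  affine_algebraic_set Z /\
  ~ exists A B : set 'rV[K]_D,
      [/\ affine_algebraic_set A, affine_algebraic_set B,
          A `<` Z, B `<` Z & Z = A `|` B].

(* Subsets of P^D are represented by the set of all homogeneous coordinate
   vectors of their points: nonzero vectors of K^(D+1). *)
Definition homogenize_point D (v : 'rV[K]_D) : 'rV[K]_D.+1 :=
  row_mx (1 : 'rV[K]_1) v.

Definition projective_closure D (Z : set 'rV[K]_D) : set 'rV[K]_D.+1 :=
  [set y | y != 0 /\
     forall (t : nat) (f : {mpoly K[D.+1]}), f \is t.-homog ->
       (forall v, Z v -> peval f (homogenize_point v) = 0) -> peval f y = 0].

Definition vanishes_on n (S : set 'rV[K]_n) (f : {mpoly K[n]}) : Prop :=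
  forall y, S y -> peval f y = 0.

(* A linearly closed predicate on a finite-dimensional space is a subspace;
   this guarantees that the choice made in ideal_part is a genuine one. *)
Lemma submod_vspace (vT : vectType K) (A : set vT) :
  A 0 -> (forall (c : K) u v, A u -> A v -> A (c *: u + v)) ->
  exists U : {vspace vT}, forall u, u \in U <-> A u.
Proof.
move=> A0 AL.
pose P k := `[< exists U : {vspace vT}, \dim U = k /\ forall u, u \in U -> A u >].
have exP : exists k, P k.
  exists 0%N; apply/asboolP; exists 0%VS; split; first exact: dimv0.
  by move=> u; rewrite memv0 => /eqP ->.
have ubP k : P k -> (k <= \dim {:vT})%N.
  by move=> /asboolP[U [<- _]]; exact/dimvS/subvf.
case: (ex_maxnP exP ubP) => k /asboolP[U [dU UA]] kmax.
exists U => u; split=> [|Au]; first exact: UA.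
apply: contraT => uU.
have : P (\dim (U + <[u]>)%VS).
  apply/asboolP; exists (U + <[u]>)%VS; split=> // w.
  move=> /memv_addP[a aU [b /vlineP[c ->] ->]].
  by rewrite addrC; apply: AL => //; exact: UA.
move=> /kmax; rewrite leqNgt -dU => /negP[].
rewrite ltn_neqAle dimvS ?addvSl // andbT.
apply: contra uU => /eqP eqd.
have /eqP -> : U == (U + <[u]>)%VS by rewrite eqEdim addvSl -eqd /=.
by rewrite memvE addvSr.
Qed.

(* The degree-t part of the ideal of polynomials vanishing on S, as a subspace
   of the space of homogeneous polynomials of degree t. *)
Definition ideal_part n (S : set 'rV[K]_n.+1) (t : nat) :
    {vspace dhomog n.+1 K t} :=
  xget 0%VS [set U | forall f : dhomog n.+1 K t, f \in U <-> vanishes_on S f].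

Lemma mem_ideal_part n (S : set 'rV[K]_n.+1) t (f : dhomog n.+1 K t) :
  f \in ideal_part S t <-> vanishes_on S f.
Proof.
rewrite /ideal_part; case: xgetP => [U _|none]; first exact.
have [y Sy|c g h gS hS y Sy|U PU] :=
    @submod_vspace (dhomog n.+1 K t) [set g | vanishes_on S g].
- by rewrite /peval /= meval0.
- by rewrite /peval /= mevalD mevalZ [meval _ _]gS // [meval _ _]hS // mulr0 addr0.
- by case: (none U).
Qed.

(* dim_K (K[x_0, ..., x_n]_t / I(S)_t) *)
Definition hilbert_function n (S : set 'rV[K]_n.+1) (t : nat) : nat :=
  (\dim {: dhomog n.+1 K t} - \dim (ideal_part S t))%N.

(* The default 0 is never used: by the Hilbert-Serre theorem exactly one
   polynomial satisfies the condition. *)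
Definition hilbert_polynomial n (S : set 'rV[K]_n.+1) : {poly rat} :=
  xget 0 [set p | exists t0 : nat, forall t : nat, (t0 <= t)%N ->
                    p.[t%:R] = (hilbert_function S t)%:R].

Definition variety_dim D (Z : set 'rV[K]_D) : nat :=
  (size (hilbert_polynomial (projective_closure Z))).-1.

Definition variety_degree D (Z : set 'rV[K]_D) : rat :=
  (variety_dim Z)`!%:R * lead_coef (hilbert_polynomial (projective_closure Z)).

End AffineVarieties.

Section Graphs.
Variable T : finType.

Definition edge_set (e : rel T) : {set {set T}} :=
  [set [set x; y]%SET | x in T, y in T & e x y]%SET.

Definition contains_copy (S : finType) (h : rel S) (e : rel T) : Prop :=
  exists2 f : S -> T, injective f & forall x y, h x y -> e (f x) (f y).

End Graphs.

Definition complete_bipartite (s t : nat) : rel ('I_s + 'I_t) :=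
  fun u w => match u, w with
             | inl _, inr _ | inr _, inl _ => true
             | _, _ => false
             end.
Arguments complete_bipartite s t : clear implicits.

Section Incidences.
Variables (F K : fieldType) (iota : {rmorphism F -> K}) (D : nat).
Variables (P : {fset 'rV[F]_D}) (V : {fset set 'rV[K]_D}).

Definition incidence_graph : rel (P + V) :=
  fun u w => match u, w with
             | inl x, inr Z | inr Z, inl x =>
                 map_mx iota (fsval x) \in (fsval Z : set 'rV[K]_D)
             | _, _ => false
             end.

Definition incidences : nat := #|edge_set incidence_graph|.

End Incidences.
Arguments incidence_graph {F K} iota {D} P V _ _.
Arguments incidences {F K} iota {D} P V.

(* Main.v *)
(* Fix a variety Z of dimension d and degree at most Delta and a
   point x outside Z. Noether normalization, performed for all such pairs
   (Z, x) at the same time, yields d+1 linear forms vanishing at x over which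
   the homogeneous coordinate ring of Z is finite. The coordinate x_0 is then
   integral over the polynomial ring generated by these forms; counting
   dimensions against the Hilbert polynomial, its minimal polynomial has degree
   at most Delta, and its coefficients are polynomials because a polynomial
   ring is integrally closed. Dehomogenizing, a polynomial of degree at most
   Delta in the d+1 forms vanishes on Z but not at x.

   Products of such polynomials are linearly independent for distinct zero
   patterns, so the points cut out at most (Delta z + d + 1)^(d+1) distinct
   subsets on any z varieties. Now let every one of m' points lie on at least
   delta varieties, and sample about s^2 n / delta varieties at random: with
   probability at least 2^-s a point lies on s sampled ones, and by
   K_{s,s}-freeness fewer than s such points share a pattern. Hence
   m' = O((n / delta)^(d+1)), so some point lies on only
   O(n m'^(-1/(d+1)) + 1) varieties; remove it and sum. *)
From HB Require Import structures.
Require Import Defs.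
From mathcomp Require Import all_boot all_order all_algebra finmap.
From mathcomp Require Import boolp classical_sets reals exp.
From mathcomp Require Import mpoly.

Set Implicit Arguments.
Unset Strict Implicit.
Unset Printing Implicit Defensive.

Import Order.TTheory GRing.Theory Num.Theory.

Local Open Scope ring_scope.

(** * Multivariate polynomials *)

(* Comparing leading monomials in [e u^j = w^j q] for large [j] shows that the
   leading monomial of [w] divides that of [u]: the division of [u] by [w] never
   gets stuck. *)
Lemma mpoly_completely_integrally_closed (K : fieldType) n
    (e u w : {mpoly K[n]}) :
  e != 0 -> (forall j, exists q, e * u ^+ j = w ^+ j * q) ->
  exists v, u = w * v.
Proof.
move=> e0; have [w0|w0] := eqVneq w 0.
  move=> /(_ 1%N) [q]; rewrite w0 !expr1 mul0r => /eqP.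
  rewrite mulf_eq0 (negPf e0) => /eqP ->.
  by exists 0; rewrite mul0r.
move: u; apply: mleadrect => u IH Hu.
have [->|u0] := eqVneq u 0; first by exists 0; rewrite mulr0.
have lewu : (mlead w <= mlead u)%MM.
  apply/mnm_lepP => i; rewrite leqNgt; apply/negP => lt_uw.
  have [q Eq] := Hu (mlead e i).+1.
  have q0 : q != 0.
    apply/negP => /eqP q0; move/eqP: Eq.
    by rewrite q0 mulr0 mulf_eq0 (negPf e0) expf_eq0 (negPf u0) andbF.
  have := congr1 (fun p => mlead p i) Eq.
  rewrite !mleadM ?expf_neq0 // !mnmDE !mleadX // !mulmnE => E.
  have : (mlead w i * (mlead e i).+1 <= mlead e i + mlead u i * (mlead e i).+1)%N.
    by rewrite E leq_addr.
  apply/negP; rewrite -ltnNge -addSn.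
  by rewrite (leq_trans _ (leq_mul lt_uw (leqnn _))) // mulSn leq_add2r.
pose t := (mleadc u / mleadc w) *: 'X_[mlead u - mlead w].
have [v Ev] : exists v, u - w * t = w * v.
  have [->|d0] := eqVneq (u - w * t) 0; first by exists 0; rewrite mulr0.
  apply: IH; last first.
    have /boolp.choice[q Eq] := Hu.
    (* By binomial expansion, [e] times each term of [(u - w * t) ^+ j] is divisible by [w ^+ j]:
       the remainder inherits the hypothesis. *)
    move=> j; exists (\sum_(i < j.+1) q (j - i)%N * (- t) ^+ i *+ 'C(j, i)).
    rewrite exprDn !mulr_sumr; apply: eq_bigr => i _.
    rewrite !mulrnAr; congr (_ *+ _); rewrite [LHS]mulrA Eq -mulrN exprMn.
    have -> : w ^+ j = w ^+ (j - i) * w ^+ i by rewrite -exprD subnK -1?ltnS.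
    by rewrite -!mulrA [q _ * _]mulrCA.
  have lt1 m : m \in msupp (u - w * t) -> m != mlead u /\ (m <= mlead u)%O.
    have t0 : t != 0.
      rewrite scaler_eq0 negb_or mulf_neq0 ?invr_eq0 ?mleadc_eq0 //=.
      by rewrite -msupp_eq0 msuppX.
    move=> mS; have tw : mlead (w * t) = mlead u.
      rewrite mleadM // mleadZ ?mulf_neq0 ?invr_eq0 ?mleadc_eq0 // mleadXm.
      by rewrite addmC submK.
    split; last first.
      apply: le_trans (msupp_le_mlead mS) _.
      by apply: le_trans (mleadB_le _ _) _; rewrite tw joinxx.
    apply: contraL mS => /eqP ->; rewrite mcoeff_msupp negbK mcoeffB.
    have -> : (w * t)@_(mlead u) = mleadc u; last by rewrite subrr.
    rewrite -[X in _@_X]tw mleadM // mleadcM /t mleadcZE mleadXm mcoeffX eqxx.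
    by rewrite mulr1 mulrC divfK // mleadc_eq0.
  have [ne le] := lt1 _ (mlead_supp d0).
  by rewrite lt_neqAle ne.
by exists (v + t); rewrite mulrDr -Ev subrK.
Qed.

Lemma dhomogS_sum (K : fieldType) n t (b : {mpoly K[n]}) :
  b \is t.+1.-homog ->
  exists g : 'I_n -> {mpoly K[n]},
    (forall i, g i \is t.-homog) /\ b = \sum_i 'X_i * g i.
Proof.
move=> hb; pose ok b := exists g : 'I_n -> {mpoly K[n]},
  (forall i, g i \is t.-homog) /\ b = \sum_i 'X_i * g i.
have ok0 : ok 0.
  by exists (fun=> 0); split=> [i|]; rewrite ?rpred0 // big1 // => i _; rewrite mulr0.
have okD p q : ok p -> ok q -> ok (p + q).
  move=> [g [hg ->]] [h [hh ->]]; exists (fun i => g i + h i); split.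
    by move=> i; rewrite rpredD.
  by rewrite -big_split; apply: eq_bigr => i _; rewrite mulrDr.
rewrite -/(ok b) [b]mpolyE big_seq.
apply: (big_ind ok) => // m mb; have /eqP := dhomog_mf hb mb.
have [i mi|m0] := pickP (fun i => m i != 0%N); last first.
  by rewrite /= mdegE big1 // => i _; apply/eqP; have := m0 i; case: eqP.
rewrite /= -[X in mdeg X](@submK _ U_(i) m) ?lep1mP // mdegD mdeg1 addn1 eqSS => dm.
exists (fun j => if j == i then b@_m *: 'X_[m - U_(i)] else 0); split.
  move=> j; case: ifP => _; last exact: rpred0.
  by apply: rpredZ; rewrite dhomogX.
rewrite (bigD1 i) //= eqxx big1 ?addr0; last first.
  by move=> j /negPf ->; rewrite mulr0.
by rewrite -scalerAr mulrC -mpolyXD submK ?lep1mP.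
Qed.

(** Induction on the number of variables: [muni] makes [p] a polynomial in the last variable, one of
    its coefficients is kept nonzero, and a nonzero univariate polynomial over an algebraically
    closed field has a nonroot. *)
Lemma mpoly_nonroot (K : closedFieldType) n (p : {mpoly K[n]}) :
  p != 0 -> exists v : 'I_n -> K, p.@[v] != 0.
Proof.
elim: n p => [|n IH] p p0.
  exists (fun=> 0); have : mleadc p != 0 by rewrite mleadc_eq0.
  apply: contra => /eqP; rewrite mevalE.
  have m0 (m : 'X_{1..0}) : m = mlead p by apply/mnmP => -[].
  have s1 : msupp p = [:: mlead p].
    apply: perm_small_eq => //; apply: uniq_perm => // m.
    by rewrite inE [m]m0 eqxx mlead_supp.
  by rewrite s1 big_seq1 big_ord0 mulr1 => ->.
pose W (m : 'X_{1..n.+1}) := [multinom m (widen_ord (leqnSn n) i) | i < n].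
pose e := mlead p ord_max.
have Ep v t : p.@[fun i => if unlift ord_max i is Some j then v j else t] =
    (map_poly (meval v) (muni p)).[t].
  rewrite mevalE muniE rmorph_sum /= horner_sum; apply: eq_bigr => m _.
  rewrite !map_polyZ /= map_polyXn !hornerE mevalZ mevalX big_ord_recr /=.
  rewrite unlift_none -mulrA; congr (_ * (_ * _)).
  apply: eq_bigr => i _; rewrite mnmE.
  have -> : widen_ord (leqnSn n) i = lift ord_max i.
    by apply: val_inj; rewrite [RHS]lift_max.
  by rewrite liftK.
(* A monomial is determined by its truncation [W] and its last exponent, so no other term of [p]
   cancels the leading one in this coefficient. *)
have q0 : (muni p)`_e != 0.
  apply/negP => /eqP /(congr1 (mcoeff (W (mlead p)))).
  rewrite mcoeff0 muniE coef_sum raddf_sum /= => /eqP.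
  rewrite (bigD1_seq (mlead p)) ?mlead_supp //= big1 ?addr0.
    rewrite !coefZ coefXn eqxx mulr1 mcoeffZ mcoeffX eqxx mulr1.
    by rewrite mleadc_eq0 (negPf p0).
  move=> m ne; rewrite !coefZ coefXn; case: eqP => [Em|]; last by rewrite mulr0 mcoeff0.
  rewrite mulr1 mcoeffZ mcoeffX; case: eqP => [EW|]; last by rewrite mulr0.
  case/eqP: ne; apply/mnmP => i; case: (unliftP ord_max i) => [j ->|->] //.
  move/mnmP: EW => /(_ j); rewrite !mnmE.
  by have -> : widen_ord (leqnSn n) j = lift ord_max j by apply: val_inj; rewrite [RHS]lift_max.
have [v qv] := IH _ q0.
have /closed_nonrootP[t rt] : map_poly (meval v) (muni p) != 0.
  apply: contra qv => /eqP E.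
  by have := coef_map (meval v) (muni p) e; rewrite E coef0 => /= <-.
by exists (fun i => if unlift ord_max i is Some j then v j else t); rewrite Ep.
Qed.

(** * Functions of bounded degree and Hilbert functions *)

(** Exchange argument for functions modulo those vanishing on [S]: if [I] were larger, a nonzero
    left kernel vector of the coefficient matrix would be a dependence among the [u i]. *)
Lemma card_le_of_span (K : fieldType) (T : Type) (S : T -> Prop)
    (I J : finType) (u : I -> T -> K) (b : J -> T -> K) :
  (forall i, exists c : J -> K, forall x, S x -> u i x = \sum_j c j * b j x) ->
  (forall c : I -> K, (forall x, S x -> \sum_i c i * u i x = 0) ->
     forall i, c i = 0) ->
  (#|I| <= #|J|)%N.
Proof.
move=> /choice[M HM] indep; rewrite leqNgt; apply/negP => lt.
pose A := \matrix_(i < #|I|, j < #|J|) M (enum_val i) (enum_val j).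
have /rowV0Pn[c /sub_kermxP cA c0] : kermx A != 0.
  rewrite kermx_eq0 /row_free neq_ltn.
  by rewrite (leq_ltn_trans (rank_leq_col A)) ?lt.
case/eqP: c0; apply/rowP => i; rewrite mxE -[i]enum_valK.
apply: (indep (fun i => c ord0 (enum_rank i))) => x Sx.
under eq_bigr do rewrite HM // mulr_sumr.
rewrite exchange_big big1 //= => j _.
have := congr1 (fun w : 'rV_#|J| => w ord0 (enum_rank j)) cA.
rewrite !mxE => E.
under eq_bigr do rewrite mulrA.
rewrite -mulr_suml [X in X * _](_ : _ = 0) ?mul0r // -[RHS]E.
rewrite [LHS](reindex (fun k : 'I_#|I| => enum_val k)) /=;
  last exact/onW_bij/enum_val_bij.
by apply: eq_bigr => k _; rewrite mxE enum_valK enum_rankK.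
Qed.

Lemma homog_basis (K : fieldType) k e :
  exists Q : 'I_('C(e + k, e)) -> {mpoly K[k.+1]},
   [/\ forall i, Q i \is e.-homog,
       forall c : _ -> K, \sum_i c i *: Q i = 0 -> forall i, c i = 0
     & forall b, b \is e.-homog -> exists c : _ -> K, b = \sum_i c i *: Q i].
Proof.
pose vT : vectType K := dhomog k.+1 K e.
have dimE : \dim {:vT} = 'C(e + k, e) by rewrite dimvf.
have sz : size (vbasis {:vT}) == 'C(e + k, e) by rewrite size_tuple dimE.
pose X := Tuple sz.
have basX : basis_of fullv X by exact: (vbasisP {:vT}).
have valE (c : 'I_('C(e + k, e)) -> K) :
    \sum_i c i *: (X`_i : {mpoly K[k.+1]}) = (\sum_i c i *: X`_i : vT).
  by rewrite raddf_sum; apply: eq_bigr.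
exists (fun i => (X`_i : {mpoly K[k.+1]})); split=> [i|c|b hb].
- exact: dhomog_is_dhomog.
- rewrite valE => c0 i; move: i; apply/freeP; first exact: basis_free basX.
  exact: val_inj.
- exists (fun i => coord X i (DHomog hb)); rewrite valE -coord_span //.
  by rewrite (span_basis basX) memvf.
Qed.

Section Polfun.
Variables (K : fieldType) (D : nat).
Implicit Types (f g h : 'rV[K]_D -> K) (Z : set 'rV[K]_D).

(* The restrictions to the chart [x_0 = 1] of the forms of degree [t]. *)
Definition polfun t f : Prop :=
  exists2 g : {mpoly K[D.+1]}, g \is t.-homog &
    forall v, f v = peval g (homogenize_point v).

Lemma polfun_ext t f g : f =1 g -> polfun t f -> polfun t g.
Proof. by move=> fg [p hp E]; exists p => // v; rewrite -fg. Qed.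

Lemma homogenize_point0 (v : 'rV[K]_D) : homogenize_point v ord0 ord0 = 1.
Proof.
rewrite /homogenize_point; have -> : ord0 = lshift D (ord0 : 'I_1) by exact: val_inj.
by rewrite [LHS](row_mxEl (1 : 'rV_1) v) mxE.
Qed.

Lemma homogenize_pointS (v : 'rV[K]_D) i :
  homogenize_point v ord0 (lift ord0 i) = v ord0 i.
Proof.
rewrite /homogenize_point; have -> : lift ord0 i = rshift 1 i by exact: val_inj.
exact: (row_mxEr (1 : 'rV_1) v).
Qed.

Lemma polfunD t f g : polfun t f -> polfun t g -> polfun t (fun v => f v + g v).
Proof.
move=> [p hp Ep] [q hq Eq]; exists (p + q); first exact: rpredD.
by move=> v; rewrite Ep Eq /peval mevalD.
Qed.

Lemma polfunM s t f g :
  polfun s f -> polfun t g -> polfun (s + t) (fun v => f v * g v).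
Proof.
move=> [p hp Ep] [q hq Eq]; exists (p * q); first exact: dhomogM.
by move=> v; rewrite Ep Eq /peval mevalM.
Qed.

Lemma polfunC t c : polfun t (fun=> c).
Proof.
exists (c *: 'X_ord0 ^+ t).
  apply: rpredZ; have := @dhomogMn _ _ mdeg 1%N ('X_ord0 : {mpoly K[D.+1]}) t.
  by rewrite mul1n; apply; rewrite dhomogX /= mdeg1.
by move=> v; rewrite /peval mevalZ rmorphXn /= mevalXU homogenize_point0 expr1n mulr1.
Qed.

Lemma polfunZ t c f : polfun t f -> polfun t (fun v => c * f v).
Proof. by move=> /(polfunM (polfunC 0 c)). Qed.

Lemma polfun_sum t (I : finType) (F : I -> 'rV[K]_D -> K) :
  (forall i, polfun t (F i)) -> polfun t (fun v => \sum_i F i v).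
Proof.
move=> HF; elim: (index_enum I) => [|i s IH].
  by apply: polfun_ext (polfunC t 0) => v; rewrite big_nil.
by apply: polfun_ext (polfunD (HF i) IH) => v; rewrite big_cons.
Qed.

Lemma polfun_coord i : polfun 1 (fun v => v ord0 i).
Proof.
exists 'X_(lift ord0 i); first by rewrite dhomogX /= mdeg1.
by move=> v; rewrite /peval mevalXU homogenize_pointS.
Qed.

Lemma polfun_leq s t f : (s <= t)%N -> polfun s f -> polfun t f.
Proof.
move=> st /(polfunM (polfunC (t - s) 1)); rewrite subnK //.
by apply: polfun_ext => v; rewrite mul1r.
Qed.

Lemma polfun0 f : polfun 0 f -> exists c, forall v, f v = c.
Proof.
move=> [p /dhomogP hp Ep]; exists p@_0 => v; rewrite Ep /peval mevalE.
have [p0|p0] := eqVneq p@_0 0.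
  rewrite p0 big_seq big1 // => m mp; move/eqP: (hp _ mp).
  rewrite mdeg_eq0 => /eqP m0; move: mp; rewrite m0 mcoeff_msupp p0.
  by rewrite eqxx.
have s1 : msupp p = [:: 0%MM].
  apply: perm_small_eq => //; apply: uniq_perm => // m; rewrite inE.
  apply/idP/eqP => [mp|->]; last by rewrite mcoeff_msupp.
  by move/eqP: (hp _ mp); rewrite mdeg_eq0 => /eqP.
rewrite s1 big_seq1 big1 ?mulr1 // => i _.
by rewrite mnm0E expr0.
Qed.

Lemma polfunS t f : polfun t.+1 f ->
  exists2 f0, polfun t f0 & exists2 g : 'I_D -> 'rV[K]_D -> K,
    forall i, polfun t (g i) &
    forall v, f v = f0 v + \sum_i v ord0 i * g i v.
Proof.
move=> [p /dhomogS_sum[q [hq ->]] Ep].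
exists (fun v => peval (q ord0) (homogenize_point v)); first by exists (q ord0).
exists (fun i v => peval (q (lift ord0 i)) (homogenize_point v)).
  by move=> i; exists (q (lift ord0 i)).
move=> v; rewrite Ep /peval raddf_sum /= big_ord_recl /= mevalM mevalXU.
rewrite homogenize_point0 mul1r; congr (_ + _); apply: eq_bigr => i _.
by rewrite mevalM mevalXU homogenize_pointS.
Qed.

Lemma polfun_prod (I : finType) (e : I -> nat) (F : I -> 'rV[K]_D -> K) :
  (forall i, polfun (e i) (F i)) ->
  polfun (\sum_i e i) (fun v => \prod_i F i v).
Proof.
move=> HF; elim: (index_enum I) => [|i s IH].
  by rewrite big_nil; apply: polfun_ext (polfunC 0 1) => v; rewrite big_nil.
rewrite big_cons; apply: polfun_ext (polfunM (HF i) IH) => v.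
by rewrite big_cons.
Qed.

Lemma polfun_mmon (I : finType) (l : I -> 'rV[K]_D -> K) (e : I -> nat) :
  (forall i, polfun 1 (l i)) ->
  polfun (\sum_i e i) (fun v => \prod_i l i v ^+ e i).
Proof.
move=> hl; apply: polfun_prod => i.
elim: (e i) => [|k IH]; first exact: polfunC.
by apply: polfun_ext (polfunM (hl i) IH) => v; rewrite exprS.
Qed.

Lemma polfun_msum t n (b : {mpoly K[n]}) (l : 'I_n -> 'rV[K]_D -> K) :
  (forall i, polfun 1 (l i)) -> (forall m, m \in msupp b -> (mdeg m <= t)%N) ->
  polfun t (fun v => b.@[fun i => l i v]).
Proof.
move=> hl ht; apply: (@polfun_ext _ (fun v =>
  \sum_(m <- msupp b) b@_m * \prod_i l i v ^+ m i)).
  by move=> v; rewrite mevalE.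
elim: (msupp b) ht => [|m s IH] ht.
  by apply: polfun_ext (polfunC t 0) => v; rewrite big_nil.
have Hm : polfun t (fun v => b@_m * \prod_i l i v ^+ m i).
  apply: polfunZ; apply: polfun_leq (polfun_mmon _ hl).
  by rewrite -mdegE ht ?mem_head.
apply: polfun_ext (polfunD Hm (IH _)) => [v|m' m's]; first by rewrite big_cons.
by apply: ht; rewrite inE m's orbT.
Qed.

Lemma polfun_homog t n (b : {mpoly K[n]}) (l : 'I_n -> 'rV[K]_D -> K) :
  (forall i, polfun 1 (l i)) -> b \is t.-homog ->
  polfun t (fun v => b.@[fun i => l i v]).
Proof. by move=> hl /dhomogP hb; apply: polfun_msum => // m /hb ->. Qed.

Lemma polfun_peval t (f : {mpoly K[D]}) : (msize f <= t.+1)%N -> polfun t (peval f).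
Proof.
move=> sf; apply: (polfun_msum (l := fun i v => v ord0 i) polfun_coord).
by move=> m /msize_mdeg_lt /leq_trans /(_ sf).
Qed.

(** Induction on the degree: in [h0 + sum v_i g_i] replace [v_i] by [(v - x)_i + x_i], and expand
    [h0 + sum x_i g_i], which has smaller degree. *)
Lemma polfun_taylor t h (x : 'rV[K]_D) : polfun t h ->
  exists2 g : 'I_D -> 'rV[K]_D -> K, forall i, polfun t.-1 (g i) &
    forall v, h v = h x + \sum_i (v - x) ord0 i * g i v.
Proof.
elim: t h => [|t IH] h.
  move=> /polfun0[c Ec]; exists (fun _ _ => 0) => [i|v]; first exact: polfunC.
  by rewrite !Ec big1 ?addr0 // => i _; rewrite mulr0.
move=> /polfunS[h0 hh0 [g hg E]].
have [|q hq Eq] := IH (fun v => h0 v + \sum_i x ord0 i * g i v).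
  by apply: polfunD => //; apply: polfun_sum => i; apply: polfunZ.
exists (fun i v => g i v + q i v).
  by move=> i; apply: polfunD => //; apply: polfun_leq (hq i); exact: leq_pred.
move=> v /=; have := Eq v; rewrite !E => Eqv.
under [in RHS]eq_bigr do rewrite mulrDr.
rewrite big_split /= addrCA -Eqv addrCA; congr (_ + _).
rewrite -big_split; apply: eq_bigr => i _ /=.
by rewrite !mxE mulrBl subrK.
Qed.

Lemma vanishes_on_closure Z t (f : {mpoly K[D.+1]}) : f \is t.-homog ->
  vanishes_on (projective_closure Z) f <->
  forall v, Z v -> peval f (homogenize_point v) = 0.
Proof.
move=> hf; split=> [fZ v Zv|fZ y [_ /(_ t f hf)]]; last exact.
apply: fZ; split=> [|s g hg]; last exact.
apply/eqP => /rowP /(_ ord0); rewrite homogenize_point0 mxE => /eqP.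
by rewrite oner_eq0.
Qed.

(** A complement of the ideal part represents the quotient; bounds on the Hilbert function thereby
    become exchange arguments for functions on [Z]. *)
Lemma hilbert_basis Z t :
  exists u : 'I_(hilbert_function (projective_closure Z) t) -> 'rV[K]_D -> K,
   [/\ forall i, polfun t (u i),
       forall f, polfun t f -> exists c : _ -> K,
         forall v, Z v -> f v = \sum_i c i * u i v
     & forall c : _ -> K, (forall v, Z v -> \sum_i c i * u i v = 0) ->
         forall i, c i = 0].
Proof.
pose vT : vectType K := dhomog D.+1 K t.
pose U : {vspace vT} := ideal_part (projective_closure Z) t.
have UP (f : vT) : f \in U <-> forall v, Z v -> peval f (homogenize_point v) = 0.
  rewrite mem_ideal_part; apply: (@vanishes_on_closure _ t).
  exact: dhomog_is_dhomog.
rewrite /hilbert_function -/vT -/U -dimv_compl.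
pose X := vbasis U^C; have basX : basis_of U^C X by exact: vbasisP.
have valE (c : 'I_(\dim U^C) -> K) w :
    peval (\sum_i c i *: X`_i : vT) w = \sum_i c i * peval (X`_i : vT) w.
  rewrite /peval !raddf_sum /=; apply: eq_bigr => i _.
  by rewrite mevalZ.
exists (fun i v => peval (X`_i : vT) (homogenize_point v)); split.
- by move=> i; exists (X`_i : vT) => //; exact: dhomog_is_dhomog.
- move=> f [g hg Eg]; pose G : vT := DHomog hg.
  have /memv_addP[a aU [b bC Eab]] : G \in (U + U^C)%VS.
    by rewrite addv_complf memvf.
  exists (fun i => coord X i b) => v Zv; rewrite -valE -coord_span; last first.
    by rewrite (span_basis basX).
  rewrite Eg -[g]/(G : {mpoly K[D.+1]}) Eab /peval /= mevalD.
  by move/UP: aU => /(_ _ Zv); rewrite /peval => ->; rewrite add0r.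
- move=> c Hc i; move: i; apply/freeP; first exact: basis_free basX.
  have : \sum_i c i *: X`_i \in (U :&: U^C)%VS.
    rewrite memv_cap; apply/andP; split; first by apply/UP => v /Hc; rewrite valE.
    by apply: memv_suml => i _; apply: memvZ; apply: vbasis_mem; apply: mem_nth; rewrite size_tuple.
  by rewrite capv_compl memv0 => /eqP.
Qed.

Lemma hilbert_ge Z t (I : finType) (u : I -> 'rV[K]_D -> K) :
  (forall i, polfun t (u i)) ->
  (forall c : _ -> K, (forall v, Z v -> \sum_i c i * u i v = 0) ->
     forall i, c i = 0) ->
  (#|I| <= hilbert_function (projective_closure Z) t)%N.
Proof.
move=> hu indep; have [b [_ span _]] := hilbert_basis Z t.
by rewrite -[leqRHS]card_ord; apply: card_le_of_span indep => i; exact: span.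
Qed.

Lemma hilbert_le Z t (I : finType) (u : I -> 'rV[K]_D -> K) :
  (forall f, polfun t f -> exists c : _ -> K,
     forall v, Z v -> f v = \sum_i c i * u i v) ->
  (hilbert_function (projective_closure Z) t <= #|I|)%N.
Proof.
move=> span; have [b [hb _ indep]] := hilbert_basis Z t.
by rewrite -[leqLHS]card_ord; apply: card_le_of_span indep => i; exact: span.
Qed.

End Polfun.

(** * Growth of Hilbert functions *)

Lemma bin_fact_bounds e k :
  (e ^ k <= 'C(e + k, e) * k`! <= (e + k) ^ k)%N.
Proof.
have -> : 'C(e + k, e) = 'C(e + k, k).
  by rewrite -[in RHS]bin_sub ?leq_addl // addnK.
have expE a : (a ^ k = \prod_(i < k) a)%N by rewrite prod_nat_const card_ord.
rewrite bin_ffact ffact_prod !expE.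
apply/andP; split; apply: leq_prod => i _; last exact: leq_subr.
by rewrite -addnBA ?leq_addr // ltnW.
Qed.

(** A negative coefficient at [n] would outweigh all lower ones. The size is only bounded, so [q]
    may be a difference whose top coefficients cancel. *)
Lemma coef_ge0_of_eventually_ge0 (q : {poly rat}) n t0 :
  (size q <= n.+1)%N -> (forall t, (t0 <= t)%N -> 0 <= q.[t%:R]) -> 0 <= q`_n.
Proof.
move=> sq q_ge0; rewrite leNgt; apply/negP => lc.
case: n lc sq => [|n] lc sq.
  have := q_ge0 t0 (leqnn _); rewrite [q]size1_polyC // hornerC.
  by rewrite leNgt lc.
pose S := \sum_(i < n.+1) `|q`_i|.
have S0 : 0 <= S by apply: sumr_ge0.
have [m Hm] : exists m : nat, S < - q`_n.+1 * m%:R.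
  exists (Num.bound (S / - q`_n.+1)); rewrite mulrC -ltr_pdivrMr ?oppr_gt0 //.
  by apply: archi_boundP; rewrite divr_ge0 // oppr_ge0 ltW.
pose t := (maxn t0 (maxn m 1)).
have t1 : 1 <= t%:R :> rat by rewrite ler1n !leq_max ltnSn !orbT.
have := q_ge0 t (leq_maxl _ _); rewrite leNgt => /negP; apply.
rewrite (horner_coef_wide _ sq) big_ord_recr /=.
apply: (@le_lt_trans _ _ ((S + q`_n.+1 * t%:R) * t%:R ^+ n)).
  rewrite mulrDl -mulrA -exprS lerD2r mulr_suml; apply: ler_sum => i _.
  apply: le_trans (ler_norm _) _; rewrite normrM normrX.
  apply: ler_wpM2l => //; rewrite ger0_norm ?ler0n //.
  by apply: ler_weXn2l => //; rewrite -ltnS.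
rewrite pmulr_llt0 ?exprn_gt0 ?(lt_le_trans ltr01) //.
rewrite -ltrBDr sub0r -mulNr (lt_le_trans Hm) //.
apply: ler_wpM2l; first by rewrite oppr_ge0 ltW.
by rewrite ler_nat !leq_max leqnn orbT.
Qed.

Lemma shift_polyE (p : {poly rat}) d c : size p = d.+1 ->
  (size (p \Po ('X + c%:P)) <= d.+1)%N /\
  (p \Po ('X + c%:P))`_d = lead_coef p.
Proof.
move=> sp; have sX : size ('X + c%:P : {poly rat}) = 2 by rewrite size_XaddC.
have s : size (p \Po ('X + c%:P)) = d.+1 by rewrite size_comp_poly2.
split; first by rewrite s.
rewrite -[in RHS](mulr1 (lead_coef p)) -(expr1n _ (size p).-1).
rewrite -(lead_coefXaddC c) -lead_coef_comp ?sX //.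
by rewrite [in RHS]lead_coefE s.
Qed.

Section Growth.
Variables (H : nat -> nat) (p : {poly rat}) (d t0 : nat).
Hypothesis sp : size p = d.+1.
Hypothesis Hp : forall t, (t0 <= t)%N -> p.[t%:R] = (H t)%:R.

Lemma growth_lead_gt0 : 0 < lead_coef p.
Proof.
rewrite lt_neqAle eq_sym lead_coef_eq0 -size_poly_eq0 sp /=.
have := @coef_ge0_of_eventually_ge0 p d t0; rewrite lead_coefE sp; apply=> //.
by move=> t /Hp ->; rewrite ler0n.
Qed.

(** Otherwise [k! p - X^k], whose coefficient at [k] is [-1], would be eventually nonnegative. The
    strict inequality later forces a relation among [k + 1] linear forms. *)
Lemma growth_lt_bin k : (d < k)%N ->
  exists2 q, (0 < q)%N & (H q < 'C(q + k, q))%N.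
Proof.
move=> dk; apply: contrapT => no.
have := @coef_ge0_of_eventually_ge0 (k`!%:R *: p - 'X^k) k (maxn t0 1).
rewrite coefB coefZ [p`_k]nth_default ?sp // mulr0 coefXn eqxx sub0r.
rewrite oppr_ge0 ler10 => HH; suff : false by []; apply: HH.
  rewrite (leq_trans (size_polyD _ _)) // geq_max size_polyN size_polyXn.
  by rewrite leqnn andbT (leq_trans (size_scale_leq _ _)) // sp leqW.
move=> t; rewrite geq_max => /andP[tt0 t1].
rewrite !hornerE Hp // -natrX -natrM subr_ge0 ler_nat.
have /andP[le _] := bin_fact_bounds t k.
apply: leq_trans le _; rewrite mulnC leq_pmul2l ?fact_gt0 //.
by rewrite leqNgt; apply/negP => lt; apply: no; exists t.
Qed.

(** The right side has order [t ^ d.-1], the growth of a module with [h] generators over [d] linear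
    forms, whereas [H] has order [t ^ d]. *)
Lemma growth_not_le_bin N h : (0 < d)%N ->
  ~ (forall t, H (t + N) <= 'C(t + d.-1, t) * h)%N.
Proof.
move=> d0 le.
have [s1 c1] := shift_polyE N%:R sp.
have := @coef_ge0_of_eventually_ge0
  (h%:R *: ('X + d%:R%:P) ^+ d.-1 - (d.-1)`!%:R *: (p \Po ('X + N%:R%:P))) d t0.
have s2 : size (('X + d%:R%:P : {poly rat}) ^+ d.-1) = d.
  have := size_exp_XsubC d.-1 (- d%:R : rat).
  by rewrite polyCN opprK prednK.
rewrite coefB !coefZ c1 [X in _ * X - _]nth_default ?s2 // mulr0 sub0r oppr_ge0.
rewrite leNgt mulr_gt0 ?growth_lead_gt0 ?ltr0n ?fact_gt0 //.
move=> HH; suff : false by []; apply: HH.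
  rewrite (leq_trans (size_polyD _ _)) // geq_max size_polyN.
  by rewrite !(leq_trans (size_scale_leq _ _)) ?s2.
move=> t tt0; rewrite !hornerE horner_comp !hornerE -(natrD _ t N) Hp; last first.
  exact: leq_trans tt0 (leq_addr _ _).
rewrite subr_ge0 -natrD -natrX -!natrM ler_nat.
have /andP[_ up] := bin_fact_bounds t d.-1.
rewrite mulnC (leq_trans (leq_mul (le t) (leqnn _))) // mulnAC mulnC leq_mul2l.
apply/orP; right; apply: leq_trans up _.
have [->|e0] := posnP d.-1; first by rewrite !expn0.
by rewrite leq_exp2r // leq_add2l leq_pred.
Qed.

(** Each of the [r] summands grows like [t ^ d / d!], so leading coefficients can be compared. *)
Lemma growth_multiplicity r Delta : 
  (forall s, \sum_(i < r) 'C((r + s - i) + d, r + s - i) <= H (r + s))%N ->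
  d`!%:R * lead_coef p <= Delta%:R -> (r <= Delta)%N.
Proof.
move=> le ub; have [s1 c1] := shift_polyE r%:R sp.
have := @coef_ge0_of_eventually_ge0
  (d`!%:R *: (p \Po ('X + r%:R%:P)) - r%:R *: 'X^d) d t0.
rewrite coefB !coefZ c1 coefXn eqxx mulr1 subr_ge0 => H1.
rewrite -(ler_nat rat); apply: le_trans ub; apply: H1.
  rewrite (leq_trans (size_polyD _ _)) // geq_max size_polyN.
  by rewrite !(leq_trans (size_scale_leq _ _)) ?size_polyXn.
move=> t tt0; rewrite !hornerE horner_comp !hornerE -(natrD _ t r) Hp; last first.
  exact: leq_trans tt0 (leq_addr _ _).
rewrite subr_ge0 -natrX -!natrM ler_nat addnC.
apply: leq_trans (leq_mul (leqnn _) (le t)).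
rewrite big_distrr /= -[X in (X * _ <= _)%N]card_ord -sum_nat_const.
apply: leq_sum => i _.
have /andP[lo _] := bin_fact_bounds (r + t - i) d.
rewrite mulnC (leq_trans _ lo) //.
have [->|d0] := posnP d; first by rewrite !expn0.
by rewrite leq_exp2r // addnC -addnBA ?leq_addr // ltnW.
Qed.

End Growth.

(** Positive dimension excludes the default 0 of [hilbert_polynomial], so the chosen polynomial has
    its defining property. *)
Lemma hilbert_polynomialP (K : fieldType) D (Z : set 'rV[K]_D) :
  (0 < variety_dim Z)%N ->
  exists (p : {poly rat}) t0,
    [/\ size p = (variety_dim Z).+1,
        (variety_dim Z)`!%:R * lead_coef p = variety_degree Z
      & forall t, (t0 <= t)%N ->
          p.[t%:R] = (hilbert_function (projective_closure Z) t)%:R].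
Proof.
rewrite /variety_degree /variety_dim => d0.
exists (hilbert_polynomial (projective_closure Z)).
have : hilbert_polynomial (projective_closure Z) != 0.
  by apply: contraTneq d0 => ->; rewrite size_poly0.
move: d0; rewrite /hilbert_polynomial; case: xgetP => [p -> [t0 Ht0]|_ d0].
  by move=> d0 _; exists t0; split => //; move: d0; case: (size _).
by rewrite eqxx.
Qed.

(** * Simultaneous Noether normalization *)

Lemma meval_homogZ (K : fieldType) n q (b : {mpoly K[n]}) (a : K) (y : 'I_n -> K) :
  b \is q.-homog -> b.@[fun i => a * y i] = a ^+ q * b.@[y].
Proof.
move=> /dhomogP hb; rewrite !mevalE mulr_sumr big_seq [RHS]big_seq.
apply: eq_bigr => m mb; rewrite mulrCA; congr (_ * _).
rewrite -(hb _ mb) /= mdegE -prodrXr -big_split; apply: eq_bigr => i _ /=.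
by rewrite exprMn.
Qed.

Lemma meval_homog0 (K : fieldType) n (b : {mpoly K[n]}) (y c : 'I_n -> K) :
  b \is 0.-homog -> b.@[y] = b.@[c].
Proof.
move=> hb; have := meval_homogZ 0 y hb; have := meval_homogZ 0 c hb.
by rewrite !expr0 !mul1r => <- <-; apply: meval_eq => i; rewrite !mul0r.
Qed.

(** Modulo the forms [y_j - c_j y_0] the point [y] becomes [y_0 c], and [b] becomes
    [y_0 ^ (q + 1) b(c)]. The cofactors arise by splitting off one variable at a time. *)
Lemma homog_eliminate (K : fieldType) k q (b : {mpoly K[k.+1]}) (c : 'I_k.+1 -> K) :
  c ord0 = 1 -> b \is q.+1.-homog ->
  exists2 e : 'I_k -> {mpoly K[k.+1]}, forall j, e j \is q.-homog &
    forall y : 'I_k.+1 -> K,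
      b.@[y] = \sum_j (y (lift ord0 j) - c (lift ord0 j) * y ord0) * (e j).@[y]
               + y ord0 ^+ q.+1 * b.@[c].
Proof.
move=> c0; elim: q b => [|q IH] b /dhomogS_sum[g [hg ->]].
  exists (fun j => g (lift ord0 j)) => // y.
  rewrite !raddf_sum mulr_sumr !big_ord_recl /= !mevalM !mevalXU c0 expr1.
  rewrite addrCA (meval_homog0 y c (hg ord0)) mul1r; congr (_ + _).
  rewrite -big_split; apply: eq_bigr => j _ /=.
  rewrite !mevalM !mevalXU (meval_homog0 y c (hg _)) mulrBl mulrA.
  by rewrite [y ord0 * _]mulrC subrK.
have /choice[e He] : forall i, exists e : 'I_k -> {mpoly K[k.+1]},
  (forall j, e j \is q.-homog) /\ forall y : 'I_k.+1 -> K,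
  (g i).@[y] = \sum_j (y (lift ord0 j) - c (lift ord0 j) * y ord0) * (e j).@[y]
               + y ord0 ^+ q.+1 * (g i).@[c].
  by move=> i; have [e he Ee] := IH _ (hg i); exists e.
exists (fun j => \sum_i 'X_i * e i j +
    (g (lift ord0 j)).@[c] *: 'X_ord0 ^+ q.+1) => [j|y].
  apply: rpredD; last first.
    apply: rpredZ; have := @dhomogMn _ _ mdeg 1%N ('X_ord0 : {mpoly K[k.+1]}) q.+1.
    by rewrite mul1n; apply; rewrite dhomogX /= mdeg1.
  apply: rpred_sum => i _; rewrite -[q.+1]add1n; apply: dhomogM; last by case: (He i).
  by rewrite dhomogX /= mdeg1.
pose w j := y (lift ord0 j) - c (lift ord0 j) * y ord0.
have E1 i : (g i).@[y] = \sum_j w j * (e i j).@[y] + y ord0 ^+ q.+1 * (g i).@[c].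
  by case: (He i).
rewrite !raddf_sum mulr_sumr /=.
under eq_bigr do rewrite mevalM mevalXU E1 mulrDr.
under [X in _ = X + _]eq_bigr => j _.
  rewrite mevalD mulrDr raddf_sum mevalZ rmorphXn /= mevalXU.
  under eq_bigr do rewrite mevalM mevalXU.
  over.
rewrite !big_split /= -addrA; congr (_ + _).
  under eq_bigr do rewrite mulr_sumr.
  rewrite exchange_big; apply: eq_bigr => j _ /=; rewrite mulr_sumr.
  by apply: eq_bigr => i _; rewrite mulrCA.
rewrite !big_ord_recl mevalM mevalXU c0 mul1r mulrA -exprS addrCA.
congr (_ + _); rewrite -big_split; apply: eq_bigr => j _ /=.
rewrite mevalM mevalXU [y ord0 ^+ q.+2]exprS [X in _ = _ + X]mulrACA.
by rewrite [y ord0 * c _]mulrC mulrBl [(g _).@[_] * _]mulrC subrK.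
Qed.

Section Finite.
Variables (K : closedFieldType) (D : nat).
Implicit Types (Z : set 'rV[K]_D) (x v : 'rV[K]_D).

Definition lin k (M : 'M[K]_(D, k)) x v : 'I_k -> K :=
  fun j => ((v - x) *m M) ord0 j.

(* The homogeneous coordinate ring of [Z] is a finite module over the
   subalgebra generated by the linear forms [lin M x]; these vanish at [x]. *)
Definition finite_over Z k (M : 'M[K]_(D, k)) x N : Prop :=
  forall f, polfun N.+1 f ->
    exists2 g : 'I_k -> 'rV[K]_D -> K, forall j, polfun N (g j) &
      forall v, Z v -> f v = \sum_j lin M x v j * g j v.

Lemma polfun_lin k (M : 'M[K]_(D, k)) x j : polfun 1 (fun v => lin M x v j).
Proof.
apply: (@polfun_ext _ _ _ (fun v => \sum_i (M i j * v ord0 i + - (x ord0 i * M i j)))).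
  by move=> v; rewrite /lin mxE; apply: eq_bigr => i _; rewrite !mxE mulrBl mulrC.
apply: polfun_sum => i; apply: polfunD; last exact: polfunC.
by apply: polfunZ; exact: polfun_coord.
Qed.

Lemma finite_over_leq Z k (M : 'M[K]_(D, k)) x N N' :
  (N <= N')%N -> finite_over Z M x N -> finite_over Z M x N'.
Proof.
move=> /subnK <-; elim: (N' - N)%N => // {}N' IH fin f.
move/(_ fin): IH => IH /polfunS[f0 hf0 [fs hfs E]].
have [g0 hg0 E0] := IH _ hf0.
have /choice[g Hg] : forall i, exists g : 'I_k -> 'rV[K]_D -> K,
    (forall j, polfun (N' + N) (g j)) /\
    forall v, Z v -> fs i v = \sum_j lin M x v j * g j v.
  by move=> i; have [g ? ?] := IH _ (hfs i); exists g.
exists (fun j v => g0 j v + \sum_i v ord0 i * g i j v) => [j|v Zv].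
  apply: polfunD; first exact: polfun_leq (hg0 j).
  apply: polfun_sum => i.
  by have := polfunM (polfun_coord K i) (proj1 (Hg i) j); rewrite add1n -addSn.
rewrite E E0 //; under [RHS]eq_bigr do rewrite mulrDr mulr_sumr.
rewrite big_split /= exchange_big; congr (_ + _); apply: eq_bigr => i _ /=.
case: (Hg i) => _ -> //; rewrite mulr_sumr; apply: eq_bigr => j _.
by rewrite mulrCA.
Qed.

(** Some equation [f] of [Z] is nonzero at [x]; subtracting a multiple of it makes [h] vanish at [x]
    without changing it on [Z], so that [polfun_taylor] yields the coordinates of [v - x]. The zero
    columns provide enough forms to start from even when [D] is small. *)
Lemma finite_over_base Z x k : affine_algebraic_set Z -> ~ Z x ->
  exists N, finite_over Z (row_mx 1%:M 0 : 'M_(D, D + k)) x N.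
Proof.
move=> [s EZ] Zx; have [f [fs fx]] : exists f, f \in s /\ peval f x != 0.
  apply: contrapT => no; apply: Zx; rewrite EZ => f fs; apply/eqP.
  by apply: contrapT => fx; apply: no; exists f; split=> //; apply/negP.
exists (msize f) => h hh; pose h1 v := h v + - (h x / peval f x) * peval f v.
have /(polfun_taylor x)[g hg Eg] : polfun (msize f).+1 h1.
  apply: polfunD => //; apply: polfunZ; apply: polfun_peval.
  exact: leq_trans (leqnSn _) (leqnSn _).
exists (fun j v => if split j is inl i then g i v else 0) => [j|v Zv].
  by case: (split j) => i //; exact: polfunC.
have -> : h v = h1 v.
  by rewrite /h1; move: Zv; rewrite EZ => /(_ _ fs) ->; rewrite mulr0 addr0.
rewrite Eg {1}/h1 mulNr divfK // subrr add0r big_split_ord /=.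
rewrite [X in _ = _ + X]big1 ?addr0 => [|i _]; last by rewrite (unsplitK (inr i)) mulr0.
apply: eq_bigr => i _; rewrite (unsplitK (inl i)) /lin mul_mx_row row_mxEl.
by rewrite mulmx1.
Qed.

(** Each use of finiteness pulls out one linear form; after [t] of them the degree is [N], where the
    [u i] span. *)
Lemma finite_over_gen Z k (M : 'M[K]_(D, k)) x N (I : finType)
    (u : I -> 'rV[K]_D -> K) t f :
  finite_over Z M x N ->
  (forall f, polfun N f -> exists c : I -> K,
     forall v, Z v -> f v = \sum_i c i * u i v) ->
  polfun (t + N) f ->
  exists2 b : I -> {mpoly K[k]}, forall i, b i \is t.-homog &
    forall v, Z v -> f v = \sum_i (b i).@[lin M x v] * u i v.
Proof.
move=> fin span; elim: t f => [|t IH] f.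
  move=> /span[c Ec]; exists (fun i => (c i)%:MP) => [i|v /Ec ->].
    by apply/dhomogP => m; rewrite msuppC; case: ifP => //; rewrite inE => _ /eqP ->; exact: mdeg0.
  by apply: eq_bigr => i _; rewrite mevalC.
move=> /(finite_over_leq (leq_addl t N) fin)[g hg Eg].
have /choice[b Hb] : forall j, exists b : I -> {mpoly K[k]},
    (forall i, b i \is t.-homog) /\
    forall v, Z v -> g j v = \sum_i (b i).@[lin M x v] * u i v.
  by move=> j; have [b ? ?] := IH _ (hg j); exists b.
exists (fun i => \sum_j 'X_j * b j i) => [i|v Zv].
  apply: rpred_sum => j _; rewrite -add1n; apply: dhomogM; last by case: (Hb j).
  by rewrite dhomogX /= mdeg1.
rewrite Eg //; under [RHS]eq_bigr do rewrite raddf_sum mulr_suml.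
rewrite exchange_big; apply: eq_bigr => j _ /=; case: (Hb j) => _ -> //.
by rewrite mulr_sumr; apply: eq_bigr => i _; rewrite mevalM mevalXU mulrA.
Qed.

Lemma finite_over_hilbert Z k (M : 'M[K]_(D, k.+1)) x N t :
  finite_over Z M x N ->
  (hilbert_function (projective_closure Z) (t + N) <=
   'C(t + k, t) * hilbert_function (projective_closure Z) N)%N.
Proof.
move=> fin; have [u [hu span _]] := hilbert_basis Z N.
have [Q [_ _ Qspan]] := homog_basis K k t.
rewrite -[X in (_ <= X * _)%N]card_ord -[X in (_ <= _ * X)%N]card_ord -card_prod.
apply: (@hilbert_le _ _ _ _ _ (fun i v => (Q i.1).@[lin M x v] * u i.2 v)) => f.
move=> /(finite_over_gen fin span)[b hb Eb].
have /choice[c Hc] : forall i, exists c : _ -> K, b i = \sum_a c a *: Q a.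
  by move=> i; exact: Qspan.
exists (fun i => c i.2 i.1) => v /Eb ->.
rewrite -(pair_bigA _ (fun a i => c i a * ((Q a).@[lin M x v] * u i v))) /=.
rewrite exchange_big; apply: eq_bigr => i _ /=.
rewrite {1}Hc raddf_sum mulr_suml; apply: eq_bigr => a _ /=.
by rewrite mevalZ mulrA.
Qed.

(** For [c ord0 = 1], the linear projection with centre [c]; its forms are those occurring in
    [homog_eliminate]. *)
Definition eliminate_mx k (M : 'M[K]_(D, k.+1)) (c : 'I_k.+1 -> K) : 'M[K]_(D, k) :=
  \matrix_(i, j) (M i (lift ord0 j) - c (lift ord0 j) * M i ord0).

Lemma lin_eliminate k (M : 'M[K]_(D, k.+1)) c x v j :
  lin (eliminate_mx M c) x v j =
  lin M x v (lift ord0 j) - c (lift ord0 j) * lin M x v ord0.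
Proof.
rewrite /lin !mxE mulr_sumr -sumrB; apply: eq_bigr => i _.
by rewrite !mxE mulrBr mulrCA.
Qed.

(** As [Q] vanishes on [Z] but not at [c], [homog_eliminate] puts [y_0 ^ (q + 1)] on [Z] into the
    ideal of the new forms. The coefficients [b i] of [f] over the [u i] have degree [q + 1], so
    they lie in that ideal as well. *)
Lemma finite_over_eliminate Z k (M : 'M[K]_(D, k.+1)) x N q
    (Q : {mpoly K[k.+1]}) (c : 'I_k.+1 -> K) :
  finite_over Z M x N -> Q \is q.+1.-homog ->
  (forall v, Z v -> Q.@[lin M x v] = 0) -> c ord0 = 1 -> Q.@[c] != 0 ->
  finite_over Z (eliminate_mx M c) x (q + N).
Proof.
move=> fin hQ QZ c0 Qc f hf.
have [u [hu span _]] := hilbert_basis Z N.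
have [b hb Eb] := finite_over_gen (t := q.+1) fin span hf.
have [e he Ee] := homog_eliminate c0 hQ.
have /choice[a Ha] : forall i, exists a : 'I_k -> {mpoly K[k.+1]},
  (forall j, a j \is q.-homog) /\ forall y : 'I_k.+1 -> K,
  (b i).@[y] = \sum_j (y (lift ord0 j) - c (lift ord0 j) * y ord0) * (a j).@[y]
               + y ord0 ^+ q.+1 * (b i).@[c].
  by move=> i; have [a ? ?] := homog_eliminate c0 (hb i); exists a.
pose g j v := \sum_i (a i j - ((b i).@[c] / Q.@[c]) *: e j).@[lin M x v] * u i v.
exists g => [j|v Zv].
  apply: polfun_sum => i; apply: polfunM; last exact: hu.
  apply: polfun_homog; first exact: polfun_lin.
  by apply: rpredB; [exact: (proj1 (Ha i) j)|apply: rpredZ; exact: he].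
rewrite Eb // /g; under [RHS]eq_bigr do rewrite mulr_sumr.
rewrite exchange_big; apply: eq_bigr => i _ /=.
under [RHS]eq_bigr => j _.
  by rewrite mevalB mevalZ lin_eliminate mulrA mulrBr mulrCA; over.
rewrite -mulr_suml sumrB -mulr_sumr; congr (_ * _).
case: (Ha i) => _ ->; congr (_ + _).
have /eqP := Ee (lin M x v); rewrite QZ // eq_sym addrC addr_eq0 => /eqP E.
by rewrite -mulrN -E [RHS]mulrCA divfK.
Qed.

Definition hilbert_growth Z d (p : {poly rat}) : Prop :=
  size p = d.+1 /\ exists t0, forall t, (t0 <= t)%N ->
    p.[t%:R] = (hilbert_function (projective_closure Z) t)%:R.

Lemma homog_relation Z k (M : 'M[K]_(D, k.+1)) x d p :
  hilbert_growth Z d p -> (d < k)%N ->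
  exists q (Q : {mpoly K[k.+1]}),
    [/\ Q \is q.+1.-homog, Q != 0 & forall v, Z v -> Q.@[lin M x v] = 0].
Proof.
move=> [sp [t0 Hp]] dk; have [[//|q] _ lt] := growth_lt_bin sp Hp dk.
have [Q [hQ indepQ _]] := homog_basis K k q.+1.
have evE (c : 'I_('C(q.+1 + k, q.+1)) -> K) v :
    (\sum_i c i *: Q i).@[lin M x v] = \sum_i c i * (Q i).@[lin M x v].
  by rewrite raddf_sum; apply: eq_bigr => i _; rewrite /= mevalZ.
apply: contrapT => no; move: lt; apply/negP; rewrite -leqNgt -[leqLHS]card_ord.
apply: (@hilbert_ge _ _ _ _ _ (fun i v => (Q i).@[lin M x v])) => [i|c Hc].
  by apply: polfun_homog => //; exact: polfun_lin.
apply: indepQ; apply/eqP; apply: contrapT => /negP Q0; apply: no.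
exists q, (\sum_i c i *: Q i); split => // [|v Zv]; last by rewrite evE Hc.
by apply: rpred_sum => i _; apply: rpredZ; exact: hQ.
Qed.

Section CommonProjection.
Variables (I : finType) (Zs : I -> set 'rV[K]_D) (xs : I -> 'rV[K]_D) (d : nat).
Hypothesis growth : forall i, exists p, hilbert_growth (Zs i) d p.

(** A single centre [c] serves all pairs: it avoids the zeros of the product of all relations and of
    the first variable, so that its first coordinate can be scaled to 1. *)
Lemma common_elimination k (M : 'M[K]_(D, k.+1)) :
  (d < k)%N -> (forall i, exists N, finite_over (Zs i) M (xs i) N) ->
  exists M' : 'M[K]_(D, k), forall i, exists N, finite_over (Zs i) M' (xs i) N.
Proof.
move=> dk fin.
have /choice[Q HQ] : forall i, exists Q : {mpoly K[k.+1]},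
    (exists q, Q \is q.+1.-homog) /\ Q != 0 /\
    forall v, Zs i v -> Q.@[lin M (xs i) v] = 0.
  move=> i; have [p gp] := growth i.
  have [q [Q [hQ Q0 QZ]]] := homog_relation M (xs i) gp dk.
  by exists Q; split=> //; exists q.
have /mpoly_nonroot[c] : 'X_ord0 * \prod_i Q i != 0.
  rewrite mulf_neq0 //; first by rewrite -msupp_eq0 msuppX.
  by apply/prodf_neq0 => i _; case: (HQ i) => _ [].
rewrite mevalM mevalXU mulf_eq0 negb_or => /andP[c0].
rewrite rmorph_prod => /prodf_neq0 Qc.
exists (eliminate_mx M (fun j => (c ord0)^-1 * c j)) => i.
have [[q hQ] [_ QZ]] := HQ i; have [N finN] := fin i.
exists (q + N)%N; apply: (finite_over_eliminate finN hQ) => //.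
  by rewrite mulVf.
by rewrite (meval_homogZ _ _ hQ) mulf_neq0 ?expf_neq0 ?invr_neq0 ?Qc.
Qed.

Lemma common_projection :
  (forall i, affine_algebraic_set (Zs i)) -> (forall i, ~ Zs i (xs i)) ->
  exists M : 'M[K]_(D, d.+1), forall i, exists N, finite_over (Zs i) M (xs i) N.
Proof.
move=> alg out; have H0 i := finite_over_base d.+1 (alg i) (@out i).
suff descent e (M : 'M[K]_(D, e + d.+1)) :
    (forall i, exists N, finite_over (Zs i) M (xs i) N) ->
    exists M' : 'M[K]_(D, d.+1), forall i, exists N, finite_over (Zs i) M' (xs i) N.
  exact: descent H0.
elim: e M => [|e IH] M fin; first by exists M.
have [||M' fin'] := @common_elimination (e + d.+1) M; [|exact: fin|exact: (IH M')].
by rewrite addnS ltnS leq_addl.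
Qed.

End CommonProjection.

(** A relation would allow one more elimination, leaving [d] forms, too few for a Hilbert polynomial
    of degree [d]. *)
Lemma homog_not_vanishing Z d p (M : 'M[K]_(D, d.+1)) x N t (Q : {mpoly K[d.+1]}) :
  (0 < d)%N -> hilbert_growth Z d p -> finite_over Z M x N ->
  Q \is t.-homog -> (forall v, Z v -> Q.@[lin M x v] = 0) -> Q = 0.
Proof.
case: d M Q => // d M Q _ [sp [t0 Hp]] fin hQ QZ; apply/eqP; apply: contraT => Q0.
(* The extra variable makes the degree positive, as an elimination requires. *)
pose Q1 := 'X_ord0 * Q.
have hQ1 : Q1 \is t.+1.-homog.
  by rewrite -(add1n t); apply: dhomogM => //; rewrite dhomogX /= mdeg1.
have Q1Z v : Z v -> Q1.@[lin M x v] = 0 by move=> Zv; rewrite mevalM QZ ?mulr0.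
have /mpoly_nonroot[c] : 'X_ord0 * Q1 != 0.
  by rewrite !mulf_neq0 // -msupp_eq0 msuppX.
rewrite mevalM mevalXU mulf_eq0 negb_or => /andP[c0 Q1c].
have fin' := finite_over_eliminate (c := fun j => (c ord0)^-1 * c j) fin hQ1 Q1Z.
move: fin'; rewrite mulVf // (meval_homogZ _ _ hQ1) mulf_neq0 ?expf_neq0 ?invr_neq0 //.
move=> /(_ erefl isT) fin'; exfalso.
apply: (growth_not_le_bin sp Hp _) => // s.
exact: (finite_over_hilbert s fin').
Qed.

End Finite.

(** * Integral closedness and minimal relations *)

Lemma sum_coef_horner1 (R : comNzRingType) n (p : {poly R}) :
  (size p <= n)%N -> \sum_(j < n) p`_j = p.[1].
Proof.
move=> sp; rewrite (horner_coef_wide _ sp); apply: eq_bigr => j _.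
by rewrite expr1n mulr1.
Qed.

Section MinimalRelation.
Variables (B : idomainType) (I : {poly B} -> Prop).
Hypothesis cic : forall e u w : B, e != 0 ->
  (forall j, exists q, e * u ^+ j = w ^+ j * q) -> exists v, u = w * v.
Hypothesis I0 : I 0.
Hypothesis ID : forall P Q, I P -> I Q -> I (P + Q).
Hypothesis IM : forall P Q, I Q -> I (P * Q).
Variables (r : nat) (P0 G : {poly B}).
Hypothesis I_min : forall P, I P -> (size P <= r.+1)%N -> P = 0.
Hypotheses (IP0 : I P0) (sP0 : size P0 = r.+2).
Hypotheses (IG : I G) (Gmonic : G \is monic).

Let c := lead_coef P0.
Let eqI (P Q : {poly B}) : Prop := I (P - Q).

Let c_neq0 : c != 0.
Proof. by rewrite lead_coef_eq0 -size_poly_eq0 sP0. Qed.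

Let eqI_refl P : eqI P P.
Proof. by rewrite /eqI subrr. Qed.

Let eqI_trans Q P R : eqI P Q -> eqI Q R -> eqI P R.
Proof. by move=> PQ QR; have := ID PQ QR; rewrite /eqI addrA subrK. Qed.

Let eqID P Q P' Q' : eqI P Q -> eqI P' Q' -> eqI (P + P') (Q + Q').
Proof. by move=> h h'; have := ID h h'; rewrite /eqI opprD addrACA. Qed.

Let eqIM R P Q : eqI P Q -> eqI (R * P) (R * Q).
Proof. by rewrite /eqI -mulrBr; exact: IM. Qed.

Let eqI_sum (J : finType) (F F' : J -> {poly B}) :
  (forall i, eqI (F i) (F' i)) -> eqI (\sum_i F i) (\sum_i F' i).
Proof.
move=> h; apply: (big_ind2 (fun a b => eqI a b)) => [|x1 x2 y1 y2 h1 h2|i _].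
- exact: eqI_refl.
- exact: eqID.
- exact: h.
Qed.

Let eqI_small (P Q : {poly B}) : (size P <= r.+1)%N -> (size Q <= r.+1)%N -> eqI P Q -> P = Q.
Proof.
move=> sP sQ /I_min PQ; apply/eqP; rewrite -subr_eq0 PQ //.
by rewrite (leq_trans (size_polyD _ _)) // geq_max size_polyN sP.
Qed.

(** Division by the monic [G] leaves finitely many powers of [X], and pseudo-division of these by
    [P0] costs a bounded power of [c]. *)
Lemma reduce_denominator :
  exists N, forall P : {poly B}, exists2 Q : {poly B}, (size Q <= r.+1)%N & eqI ((c ^+ N)%:P * P) Q.
Proof.
pose s (l : 'I_(size G)) := scalp ('X^l : {poly B}) P0.
exists (\sum_l s l)%N => P.
have EP : P = Pdiv.Ring.rdivp P G * G + Pdiv.Ring.rmodp P G by apply: Pdiv.RingMonic.rdivp_eq.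
have sm : (size (Pdiv.Ring.rmodp P G) <= size G)%N.
  by apply: ltnW; rewrite Pdiv.Ring.ltn_rmodp -lead_coef_eq0 (monicP Gmonic) oner_eq0.
have /choice[Q HQ] : forall l : 'I_(size G), exists Q : {poly B},
    (size Q <= r.+1)%N /\ eqI ((c ^+ (\sum_l s l)%N)%:P * 'X^l) Q.
  move=> l; exists ((c ^+ (\sum_l s l - s l)%N)%:P * ('X^l %% P0)); split.
    rewrite mul_polyC (leq_trans (size_scale_leq _ _)) // -ltnS -sP0 ltn_modp.
    by rewrite -size_poly_eq0 sP0.
  have -> : c ^+ (\sum_l s l)%N = c ^+ (\sum_l s l - s l)%N * c ^+ s l.
    by rewrite -exprD subnK // (bigD1 l) //= leq_addr.
  rewrite polyCM -mulrA; apply: eqIM.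
  rewrite mul_polyC Pdiv.Idomain.divp_eq /eqI addrK.
  exact: IM.
exists (\sum_(l < size G) (Pdiv.Ring.rmodp P G)`_l *: Q l).
  apply: (leq_trans (size_sum _ _ _)); apply/bigmax_leqP => l _.
  by rewrite (leq_trans (size_scale_leq _ _)) //; case: (HQ l).
apply: (@eqI_trans ((c ^+ (\sum_l s l)%N)%:P * Pdiv.Ring.rmodp P G)).
  by apply: eqIM; rewrite {1}EP /eqI addrK; exact: IM.
rewrite {1}[Pdiv.Ring.rmodp P G](_ : _ =
    \sum_(l < size G) (Pdiv.Ring.rmodp P G)`_l *: 'X^l); last first.
  rewrite -poly_def; apply/polyP => i; rewrite coef_poly.
  by case: ltnP => // le; rewrite nth_default // (leq_trans sm).
rewrite mulr_sumr; apply: eqI_sum => l; rewrite -!mul_polyC mulrCA.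
by apply: eqIM; case: (HQ l).
Qed.

(** The small representative of [c (1 - X) X^i] modulo [I]: only the last index reaches degree
    [r + 1], and adding [P0] cancels its top term. *)
Let R (i : 'I_r.+1) : {poly B} :=
  c *: ('X^i - 'X^(i.+1)) + (if i == ord_max then P0 else 0).

Let size_R i : (size (R i) <= r.+1)%N.
Proof.
apply/leq_sizeP => j rj; rewrite /R coefD coefZ coefB !coefXn.
have /gtn_eqF -> : (i < j)%N by apply: leq_trans rj.
case: (i =P ord_max) => [->|/eqP ne] /=.
  move: rj; rewrite leq_eqVlt => /predU1P[<-|lt].
    by rewrite eqxx sub0r mulrN1 -[c]/(P0`_(size P0).-1) sP0 /= addNr.
  by rewrite nth_default ?sP0 // (gtn_eqF lt) subrr mulr0 addr0.
have lt : (i < r)%N.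
  rewrite ltn_neqAle -ltnS ltn_ord andbT.
  by apply: contra ne => /eqP e; apply/eqP/val_inj.
by rewrite coef0 addr0 (gtn_eqF (leq_ltn_trans lt rj)) subrr mulr0.
Qed.

Let eqI_R i : eqI (R i) (c%:P * (1 - 'X) * 'X^i).
Proof.
rewrite /R /eqI -mul_polyC -mulrA mulrBl mul1r -exprS [_ + (if _ then _ else _)]addrC addrK.
by case: ifP.
Qed.

(* The matrix of multiplication by [c (1 - X)] modulo [I], in the basis of the
   powers of [X]. *)
Let A : 'M[B]_r.+1 := \matrix_i poly_rV (R i).

Let eqI_mulA (a : 'rV[B]_r.+1) :
  eqI (rVpoly (a *m A)) (c%:P * (1 - 'X) * rVpoly a).
Proof.
have -> : rVpoly (a *m A) = \sum_i a ord0 i *: R i.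
  rewrite mulmx_sum_row raddf_sum; apply: eq_bigr => i _ /=.
  by rewrite linearZ /= rowK poly_rV_K.
have -> : rVpoly a = \sum_i a ord0 i *: 'X^i.
  rewrite /rVpoly poly_def; apply: eq_bigr => i _.
  by rewrite valK.
rewrite mulr_sumr; apply: eqI_sum => i; rewrite -!mul_polyC mulrCA.
exact/eqIM/eqI_R.
Qed.

Let eqI_mulAX j (a : 'rV[B]_r.+1) :
  eqI (rVpoly (a *m A ^+ j)) ((c%:P * (1 - 'X)) ^+ j * rVpoly a).
Proof.
elim: j a => [|j IH] a; first by rewrite !expr0 mulmx1 mul1r.
rewrite exprS mulmxA; apply: eqI_trans (IH _) _.
by rewrite exprSr -mulrA; apply: eqIM; exact: eqI_mulA.
Qed.

Let detX j : \det (A ^+ j) = \det A ^+ j.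
Proof.
by elim: j => [|j IH]; rewrite ?expr0 ?det1 // !exprS det_mulmx IH.
Qed.

(* As [G] is monic, the powers of [X] have the common denominator [c ^ N] modulo
   [I]; hence [c ^ N A^j] is divisible by [c ^ j] for all [j]. *)
Let lead_dvd_det : exists v, \det A = c ^+ r.+1 * v.
Proof.
have [N red] := reduce_denominator.
apply: (cic (e := (c ^+ N) ^+ r.+1)); first by rewrite !expf_neq0.
move=> j; have /choice[Q HQ] : forall i : 'I_r.+1, exists Q : {poly B},
    (size Q <= r.+1)%N /\ eqI ((c ^+ N)%:P * ((1 - 'X) ^+ j * 'X^i)) Q.
  by move=> i; have [Q ? ?] := red ((1 - 'X) ^+ j * 'X^i); exists Q.
have E : c ^+ N *: A ^+ j = c ^+ j *: \matrix_i poly_rV (Q i).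
  apply/row_matrixP => i; rewrite !linearZ /= rowK.
  apply: (can_inj rVpolyK); rewrite !linearZ /= poly_rV_K; last by case: (HQ i).
  (* Both rows have degree at most [r] and are congruent modulo [I], hence equal by [I_min]. *)
  apply: eqI_small; rewrite ?(leq_trans (size_scale_leq _ _)) ?size_poly //.
    by case: (HQ i).
  rewrite rowE -!mul_polyC.
  apply: (eqI_trans (eqIM _ (eqI_mulAX j _))).
  rewrite rVpoly_delta exprMn -polyC_exp -mulrA mulrCA; apply: eqIM.
  by case: (HQ i).
exists (\det (\matrix_i poly_rV (Q i) : 'M_r.+1)).
by rewrite -detX -detZ E detZ -exprM mulnC exprM.
Qed.

(** The row sums of [A] are the values of the [R i] at 1: zero except for the last, [P0.[1]]. So
    [\det A] is this value times the cofactor at the last row and first column, whose minor is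
    triangular with diagonal [- c]; the signs cancel. *)
Let detA : \det A = P0.[1] * c ^+ r.
Proof.
have Aone : A *m const_mx 1 = \col_i (if i == ord_max then P0.[1] else 0) :> 'cV_r.+1.
  apply/colP => i; rewrite !mxE.
  under eq_bigr do rewrite !mxE mulr1.
  rewrite (sum_coef_horner1 (size_R i)).
  rewrite /R hornerD hornerZ !hornerE !expr1n subrr mulr0 add0r.
  by case: ifP; rewrite ?hornerE.
have := congr1 (fun w : 'cV_r.+1 => (\adj A *m w) ord0 ord0) Aone.
rewrite mulmxA mul_adj_mx mul_scalar_mx !mxE mulr1 => ->.
rewrite (bigD1 ord_max) //= big1 ?addr0 => [|i /negPf ne]; last first.
  by rewrite !mxE ne mulr0.
rewrite !mxE eqxx mulrC; congr (_ * _).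
rewrite /cofactor addn0 /= det_trig; last first.
  apply/is_trig_mxP => i j ij; rewrite !mxE /R coefD coefZ coefB !coefXn.
  rewrite [_ == ord_max]eq_sym (negPf (neq_lift _ _)) coef0 addr0 lift_max lift0.
  by rewrite eqSS !gtn_eqF ?subrr ?mulr0 // ltnS ltnW.
rewrite (eq_bigr (fun=> - c)) => [|i _].
  by rewrite prodr_const card_ord -exprMn mulN1r opprK.
rewrite !mxE /R coefD coefZ coefB !coefXn.
rewrite [_ == ord_max]eq_sym (negPf (neq_lift _ _)) coef0 addr0 lift_max lift0.
by rewrite eqxx gtn_eqF // sub0r mulrN1.
Qed.

(** Over the fraction field, [P0 / c] is the minimal polynomial of [X] modulo [I], and its value at
    1 is the norm of [1 - X]. As [\det A] is [c ^+ r.+1] times this norm, the norm lies in [B]. *)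
Lemma lead_dvd_minimal_relation : exists w, P0.[1] = c * w.
Proof.
have [v Ev] := lead_dvd_det; exists v.
apply: (mulIf (expf_neq0 r c_neq0)); rewrite -detA Ev exprS.
by rewrite mulrAC.
Qed.

End MinimalRelation.

(** * Homogenization and restriction to lines through the origin *)

Section Cone.
Variables (K : fieldType) (n : nat).
Implicit Types (b F : {mpoly K[n]}) (y : 'I_n -> K).

Lemma homog0C b : b \is 0.-homog -> b = (b@_0)%:MP.
Proof.
move=> hb; apply/mpolyP => m; rewrite mcoeffC.
have [->|m0] := eqVneq m 0%MM; first by rewrite mulr1.
by rewrite mulr0 (dhomog_nemf_coeff hb) //= mdeg_eq0.
Qed.

(** Restriction to the line spanned by [y]; it separates the homogeneous parts of a polynomial as
    coefficients. *)
Definition cone y : {mpoly K[n]} -> {poly K} := mmap polyC (fun j => y j *: 'X).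

HB.instance Definition _ y :=
  GRing.RMorphism.copy (cone y) (mmap polyC (fun j => y j *: 'X)).

Lemma cone_homog y t b : b \is t.-homog -> cone y b = b.@[y] *: 'X^t.
Proof.
move=> /dhomogP hb; rewrite /cone /mmap mevalE scaler_suml big_seq [RHS]big_seq.
apply: eq_bigr => m mb; rewrite mul_polyC -scalerA; congr (_ *: _).
rewrite /mmap1 -(hb _ mb) /= mdegE -prodrXr -mul_polyC rmorph_prod -big_split.
by apply: eq_bigr => i _ /=; rewrite exprZn -mul_polyC.
Qed.

Lemma coef_cone y b d : (cone y b)`_d = (pihomog mdeg d b).@[y].
Proof.
pose k := maxn (msize b) d.+1.
rewrite {1}(@pihomog_partitionE _ _ mdeg k b) ?leq_maxl // rmorph_sum coef_sum.
have dk : (d < k)%N by rewrite leq_maxr.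
rewrite (bigD1 (Ordinal dk)) //= big1 ?addr0 => [|i ne].
  by rewrite (cone_homog _ (pihomogP _ _ _)) coefZ coefXn eqxx mulr1.
rewrite (cone_homog _ (pihomogP _ _ _)) coefZ coefXn.
have -> : (d == i) = false; last by rewrite mulr0.
by apply: contraNF ne => /eqP E; apply/eqP/val_inj.
Qed.

Lemma meval0_pihomog b y : b.@[fun=> 0] = (pihomog mdeg 0 b).@[y].
Proof.
rewrite {1}(@pihomog_partitionE _ _ mdeg (msize b).+1 b) ?leqnSn //.
rewrite raddf_sum big_ord_recl /= big1 ?addr0 => [|i _].
  exact: meval_homog0 (pihomogP _ _ _).
have := meval_homogZ 0 y (pihomogP mdeg (lift ord0 i) b).
rewrite expr0n /= mul0r => E; rewrite -[RHS]E.
by apply: meval_eq => j; rewrite mul0r.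
Qed.

Definition homogenization t F : {poly {mpoly K[n]}} :=
  \poly_(i < t.+1) pihomog mdeg (t - i) F.

Lemma homogenization1 t F : (msize F <= t.+1)%N -> (homogenization t F).[1] = F.
Proof.
move=> sF; rewrite -(@sum_coef_horner1 _ t.+1) ?size_poly //.
rewrite [RHS](@pihomog_partitionE _ _ mdeg t.+1 F) // (reindex_inj rev_ord_inj).
apply: eq_bigr => i _; rewrite coef_poly ltn_ord /= subSS subKn //.
by rewrite -ltnS.
Qed.

(** Restriction to the line spanned by [(1, y)]. It is zero when every homogeneous part of [P]
    vanishes at [(1, y)], a condition that defines an ideal containing inhomogeneous [P] too. *)
Definition cone_poly y (P : {poly {mpoly K[n]}}) : {poly K} :=
  (map_poly (cone y) P).['X].

Lemma cone_polyD y P Q : cone_poly y (P + Q) = cone_poly y P + cone_poly y Q.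
Proof. by rewrite /cone_poly rmorphD hornerD. Qed.

Lemma cone_polyM y P Q : cone_poly y (P * Q) = cone_poly y P * cone_poly y Q.
Proof. by rewrite /cone_poly rmorphM hornerM. Qed.

Lemma cone_polyE y k (P : {poly {mpoly K[n]}}) : (size P <= k)%N ->
  cone_poly y P = \sum_(i < k) cone y P`_i * 'X^i.
Proof.
move=> sP; rewrite /cone_poly (@horner_coef_wide _ k); last first.
  exact: leq_trans (size_poly _ _) sP.
by apply: eq_bigr => i _; rewrite coef_map.
Qed.

Lemma cone_homogenization y t F : (msize F <= t.+1)%N ->
  cone_poly y (homogenization t F) = F.@[y] *: 'X^t.
Proof.
move=> sF; rewrite (@cone_polyE _ t.+1) ?size_poly //.
rewrite -[in RHS](homogenization1 sF) -(@sum_coef_horner1 _ t.+1) ?size_poly //.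
rewrite raddf_sum scaler_suml; apply: eq_bigr => i _.
rewrite coef_poly ltn_ord (cone_homog _ (pihomogP _ _ _)) -scalerAl -exprD subnK //.
by rewrite -ltnS.
Qed.

Lemma coef_cone_poly y t (P : {poly {mpoly K[n]}}) : (cone_poly y P)`_t =
  \sum_(i < size P | (i <= t)%N) (pihomog mdeg (t - i) P`_i).@[y].
Proof.
rewrite (@cone_polyE _ (size P)) // coef_sum [RHS]big_mkcond.
apply: eq_bigr => i _; rewrite coefMXn.
by case: leqP => //= _; exact: coef_cone.
Qed.

End Cone.

(** * Equations of bounded degree with constant term 1 *)

Section BoundedEquation.
Variables (K : closedFieldType) (n : nat) (T : Type) (Z : T -> Prop).
Variable y : T -> 'I_n -> K.

Definition vanish (F : {mpoly K[n]}) : Prop := forall v, Z v -> F.@[y v] = 0.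

Hypothesis vanish_homog : forall t Q, Q \is t.-homog -> vanish Q -> Q = 0.
Hypothesis vanish_prime : forall F G, vanish (F * G) -> vanish F \/ vanish G.

(* The homogenization of such an [F] is an equation of degree [r] for the
   homogenizing variable over the polynomial ring. *)
Definition has_width r : Prop := exists e F,
  [/\ vanish F, pihomog mdeg e F != 0 &
      forall m, m \in msupp F -> (e <= mdeg m <= e + r)%N].

Let van (P : {poly {mpoly K[n]}}) : Prop := forall v, Z v -> cone_poly (y v) P = 0.

(** In some degree [e] the leading coefficient is nonzero; the part of [P] of total degree [e + s],
    with the outer variable set to 1, serves as [F]. *)
Lemma van_width (P : {poly {mpoly K[n]}}) s :
  van P -> size P = s.+1 -> has_width s.
Proof.
move=> vP sP.
have a0 : P`_s != 0.
  by rewrite -[s]/(s.+1.-1) -sP -lead_coefE lead_coef_eq0 -size_poly_eq0 sP.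
have [e ae] : exists e, pihomog mdeg e P`_s != 0.
  apply: contrapT => no; case/eqP: a0.
  rewrite (@pihomog_partitionE _ _ mdeg (msize P`_s) P`_s) // big1 // => d _.
  by apply/eqP; apply: contrapT => /negP h; apply: no; exists d.
pose F := \sum_(i < s.+1) pihomog mdeg (e + s - i) P`_i.
have F1 v : Z v -> F.@[y v] = 0.
  move=> Zv; have := congr1 (fun q : {poly K} => q`_(e + s)) (vP v Zv).
  rewrite coef0 coef_cone_poly sP => <-; rewrite raddf_sum [RHS]big_mkcond.
  apply: eq_bigr => i _; rewrite ifT //.
  by rewrite (leq_trans _ (leq_addl _ _)) // -ltnS.
exists e, F; split => //.
  rewrite raddf_sum big_ord_recr /= big1 ?add0r => [|i _].
    by rewrite addnK pihomog_id.
  apply: pihomog_ne0 (pihomogP _ _ _).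
  by rewrite -addnBA 1?ltnW // -[X in _ != X]addn0 eqn_add2l -lt0n subn_gt0.
move=> m /msupp_sum_le /flatten_mapP[i _ mi].
rewrite (dhomog_mf (pihomogP mdeg (e + s - i) _) mi).
by rewrite leq_subr andbT -addnBA ?leq_addr // -ltnS.
Qed.

(** For [F] of least width, with lowest part [c], the homogenization is a relation of least degree
    with leading coefficient [c], and that of [G] is monic; so [F = c * w]. As the nonzero form [c]
    does not vanish on all of [Z], primality makes [w] vanish there, and [w] has degree at most the
    width. *)
Lemma vanish_bounded G Delta :
  vanish G -> G.@[fun=> 0] = 1 ->
  (forall r, (forall s, (s < r)%N -> ~ has_width s) -> (r <= Delta)%N) ->
  exists2 w : {mpoly K[n]}, vanish w & w.@[fun=> 0] = 1 /\ (msize w <= Delta.+1)%N.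
Proof.
move=> vG G0 width_le.
have pG0 : pihomog mdeg 0 G = 1.
  have hG := pihomogP mdeg 0 G; rewrite (homog0C hG).
  by have := meval0_pihomog G (fun=> 0); rewrite G0 {1}(homog0C hG) mevalC => <-.
have ex_width : exists r, `[< has_width r >].
  exists (msize G); apply/asboolP; exists 0%N, G; split=> //.
    by rewrite pG0 oner_neq0.
  by move=> m /msize_mdeg_lt /ltnW.
case: (ex_minnP ex_width) => r /asboolP[e [F [vF c0 dF]]] rmin.
have rD : (r <= Delta)%N.
  by apply: width_le => s sr /asboolP /rmin; rewrite leqNgt sr.
pose c := pihomog mdeg e F.
have msF : (msize F <= (e + r).+1)%N.
  by rewrite mmeasureE; apply/bigmax_leqP_seq => m /dF /andP[_ le] _; rewrite ltnS.
suff [w Ew] : exists w, F = c * w.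
  have w0 : w != 0.
    apply/negP => /eqP E; move: c0; rewrite Ew E mulr0 pihomog0 eqxx //.
  exists w.
    move: vF; rewrite Ew => /vanish_prime[|//].
    by move=> /(vanish_homog (pihomogP _ _ _))/eqP; rewrite (negPf c0).
  have [y0 cy0] := mpoly_nonroot c0; split.
    (* On a line where [c] is nonzero, comparing coefficients of degree [e] in [F = c * w] gives the
       constant term 1. *)
    rewrite (meval0_pihomog w y0) -coef_cone.
    have := coef_cone y0 F e; rewrite {1}Ew rmorphM /=.
    rewrite (cone_homog _ (pihomogP _ _ _)) -scalerAl coefZ coefXnM ltnn subnn -/c.
    by move=> /(canRL (mulKf cy0)) ->; rewrite mulVf.
  move: msF; rewrite Ew msizeM // -(mlead_deg c0).
  have := dhomog_mf (pihomogP mdeg e F) (mlead_supp c0); rewrite /= -/c => ->.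
  by rewrite -addnS leq_add2l => /leq_trans; apply; rewrite ltnS.
(* Width zero means [F = c]; the divisibility lemma is for relations of positive degree. *)
case: r vF dF rmin rD msF => [|r] vF dF rmin rD msF.
  exists 1; rewrite mulr1 /c pihomog_dE //; apply/dhomogP => m /dF.
  by rewrite addn0 -eqn_leq eq_sym => /eqP.
have van_hz t H : (msize H <= t.+1)%N -> vanish H -> van (homogenization t H).
  by move=> sH vH v Zv; rewrite cone_homogenization // vH // scale0r.
pose P0 := homogenization (e + r.+1) F.
have P0e i : (r.+1 < i)%N -> P0`_i = 0.
  move=> ri; rewrite coef_poly; case: ltnP => // ile.
  rewrite pihomogE big_seq_cond big1 // => m /andP[/dF /andP[em _] /eqP E].
  move: em; rewrite E leq_subRL; last by rewrite -ltnS.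
  by rewrite [(i + e)%N]addnC leq_add2l leqNgt ri.
have P0r : P0`_r.+1 = c by rewrite coef_poly ltnS leq_addl addnK.
have sP0 : size P0 = r.+2.
  apply/eqP; rewrite eqn_leq; apply/andP; split; first by apply/leq_sizeP => i; exact: P0e.
  by rewrite ltnNge; apply/negP => /leq_sizeP /(_ _ (leqnn _)) /eqP; rewrite P0r (negPf c0).
pose G1 := homogenization (msize G) G.
have G1m : G1 \is monic.
  have lG : G1`_(msize G) = 1 by rewrite coef_poly ltnSn subnn.
  have sG : size G1 = (msize G).+1.
    apply/eqP; rewrite eqn_leq size_poly ltnNge; apply/negP => /leq_sizeP /(_ _ (leqnn _)) /eqP.
    by rewrite lG oner_eq0.
  by rewrite monicE lead_coefE sG lG.
have lc : lead_coef P0 = c by rewrite lead_coefE sP0.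
rewrite -(homogenization1 msF) -/P0 -lc.
apply: (@lead_dvd_minimal_relation _ van _ _ _ _ r P0 G1) => //.
- exact: mpoly_completely_integrally_closed.
- by move=> v Zv; rewrite /cone_poly rmorph0 horner0.
- by move=> P Q hP hQ v Zv; rewrite cone_polyD hP // hQ // addr0.
- by move=> P Q hQ v Zv; rewrite cone_polyM hQ // mulr0.
- move=> P vP sP; apply/eqP; apply: contraT; rewrite -size_poly_eq0.
  case E : (size P) sP => [//|s] sr _.
  by have /asboolP /rmin := van_width vP E; rewrite leqNgt sr.
- exact: van_hz.
- by apply: van_hz => //; apply: leqnSn.
Qed.

End BoundedEquation.

(** * Separating a point from a variety *)

Section Separator.
Variables (K : closedFieldType) (D : nat).
Implicit Types (Z : set 'rV[K]_D) (x v : 'rV[K]_D).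

Lemma variety_prime Z (f g : {mpoly K[D]}) : affine_variety Z ->
  (forall v, Z v -> peval (f * g) v = 0) ->
  (forall v, Z v -> peval f v = 0) \/ (forall v, Z v -> peval g v = 0).
Proof.
move=> [[s EZ] irr] fgZ; apply: contrapT => /not_orP[nf ng]; apply: irr.
pose A (h : {mpoly K[D]}) : set 'rV[K]_D := [set v | Z v /\ peval h v = 0]%classic.
have Aalg h : affine_algebraic_set (A h).
  exists (h :: s); rewrite /A EZ; apply/seteqP; split=> v /=.
    by move=> [sv hv] k; rewrite inE => /predU1P[->|/sv].
  move=> hv; split=> [k ks|]; first by apply: hv; rewrite inE ks orbT.
  by apply: hv; rewrite inE eqxx.
have Aprop h : ~ (forall v, Z v -> peval h v = 0) -> (A h `<` Z)%classic.
  move=> nh; split=> [v []//|ZA]; apply: nh => v /ZA[].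
  by [].
exists (A f), (A g); split => //; try exact: Aprop.
apply/seteqP; split=> [v Zv|v [] []//].
have /eqP := fgZ v Zv; rewrite /peval mevalM mulf_eq0.
by move=> /orP[] /eqP; [left|right].
Qed.

Lemma lin_mpoly k (M : 'M[K]_(D, k)) x :
  exists L : {rmorphism {mpoly K[k]} -> {mpoly K[D]}},
    forall b v, peval (L b) v = b.@[lin M x v].
Proof.
pose t := [tuple \sum_i M i j *: ('X_i - (x ord0 i)%:MP) : {mpoly K[D]} | j < k].
exists (comp_mpoly t) => b v; rewrite /peval comp_mpoly_meval.
apply: meval_eq => j; rewrite tnth_mktuple raddf_sum /lin mxE.
by apply: eq_bigr => i _; rewrite /= mevalZ mevalB mevalXU mevalC !mxE mulrC.
Qed.

(** Determinant trick: on [Z] the [u i] satisfy [u = m u] with entries of [m] linear in the forms,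
    so [\det (1 - m)] kills every [u i], hence the function 1 in their span. At the origin [m] is
    zero. *)
Lemma finite_over_unit_equation Z k (M : 'M[K]_(D, k)) x N :
  finite_over Z M x N ->
  exists2 G : {mpoly K[k]}, G.@[fun=> 0] = 1 & forall v, Z v -> G.@[lin M x v] = 0.
Proof.
move=> fin; have [u [hu span _]] := hilbert_basis Z N.
set H := hilbert_function _ _ in u hu span.
have /choice[b Hb] : forall i, exists b : 'I_H -> {mpoly K[k]},
    (forall j, b j \is 1.-homog) /\
    forall v, Z v -> u i v = \sum_j (b j).@[lin M x v] * u j v.
  move=> i; have [|b ? ?] := finite_over_gen (t := 1) (f := u i) fin span.
    exact: polfun_leq (hu i).
  by exists b.
pose m : 'M[{mpoly K[k]}]_H := \matrix_(i, j) b i j.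
have detE y : (\det (1%:M - m)).@[y] = \det (1%:M - map_mx (meval y) m).
  by rewrite -det_map_mx map_mxB map_mx1.
exists (\det (1%:M - m)) => [|v Zv]; rewrite detE.
  rewrite [map_mx _ _](_ : _ = 0) ?subr0 ?det1 //; apply/matrixP => i j.
  rewrite !mxE; have := meval_homogZ 0 (fun=> 0) (proj1 (Hb i) j).
  by rewrite expr1 mul0r => ->; rewrite mul0r.
pose w := \col_i u i v : 'cV_H.
set A := 1%:M - _; have Aw : A *m w = 0.
  apply/colP => i; rewrite mulmxBl mul1mx !mxE (proj2 (Hb i)) //.
  by apply/eqP; rewrite subr_eq0; apply/eqP/eq_bigr => j _; rewrite !mxE.
have [c Ec] := span _ (polfunC D N (1 : K)).
have := congr1 (mulmx (\adj A)) Aw; rewrite mulmxA mul_adj_mx mul_scalar_mx mulmx0.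
move=> /eqP; rewrite scaler_eq0 => /orP[/eqP//|/eqP w0].
have := Ec v Zv; rewrite big1 => [/eqP|i _]; first by rewrite oner_eq0.
by have := congr1 (fun w : 'cV_H => w i ord0) w0; rewrite !mxE => ->; rewrite mulr0.
Qed.

(** The powers [x_0 ^ i], [i < r], times bases of forms of complementary degree are independent on
    [Z], since a dependence would have width less than [r]. The Hilbert function bounds their
    number. *)
Lemma width_le_degree Z d p (M : 'M[K]_(D, d.+1)) x Delta r :
  hilbert_growth Z d p -> d`!%:R * lead_coef p <= Delta%:R ->
  (forall s, (s < r)%N -> ~ has_width Z (lin M x) s) -> (r <= Delta)%N.
Proof.
move=> [sp [t0 Hp]] deg no_width; apply: (growth_multiplicity sp Hp) deg => s.
pose N (i : 'I_r) := 'C((r + s - i) + d, r + s - i).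
have QE (i : 'I_r) : exists Q : 'I_(N i) -> {mpoly K[d.+1]},
   (forall a, Q a \is (r + s - i).-homog) /\
   forall c : _ -> K, \sum_a c a *: Q a = 0 -> forall a, c a = 0.
  by have [Q [? ? _]] := homog_basis K d (r + s - i); exists Q.
pose Q i := sval (cid (QE i)).
have hQ i a : Q i a \is (r + s - i).-homog.
  by case: (svalP (cid (QE i))) => h _; exact: h.
have indepQ i : forall c : _ -> K, \sum_a c a *: Q i a = 0 -> forall a, c a = 0.
  by case: (svalP (cid (QE i))) => _ h; exact: h.
pose u (ia : {i : 'I_r & 'I_(N i)}) v := (Q (tag ia) (tagged ia)).@[lin M x v].
have -> : (\sum_(i < r) N i = #|{: {i : 'I_r & 'I_(N i)}}|)%N.
  rewrite card_tagged sumnE big_map big_enum.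
  by apply: eq_bigr => i _; rewrite card_ord.
apply: (@hilbert_ge _ _ _ _ _ u) => [ia|c Hc].
  apply: (@polfun_leq _ _ (r + s - tag ia)); first exact: leq_subr.
  by apply: polfun_homog (hQ _ _) => j; exact: polfun_lin.
pose q i := \sum_a c (Tagged (fun i => 'I_(N i)) a) *: Q i a.
have hq i : q i \is (r + s - i).-homog.
  by apply: rpred_sum => a _; apply: rpredZ; exact: hQ.
suff q0 i : q i = 0 by case=> i a; exact: (indepQ i _ (q0 i) a).
apply/eqP; apply: contraT => qi.
(* For the last index [j] with [q j] nonzero, the degrees in the sum range from [r + s - j] to at
   most [r + s]: its width is [j]. *)
have [j qj jmax] : exists2 j, q j != 0 & forall l, q l != 0 -> (l <= j)%N.
  by case: (@arg_maxnP _ i (fun j => q j != 0) val qi) => j; exists j.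
case: (no_width j (ltn_ord j)); exists (r + s - j)%N, (\sum_l q l).
have jrs (l : 'I_r) : (l <= r + s)%N by rewrite (leq_trans (ltnW (ltn_ord l))) ?leq_addr.
split.
- move=> v Zv; rewrite -[RHS](Hc v Zv) /u raddf_sum.
  rewrite (eq_bigr (fun l => \sum_(a < N l)
    c (Tagged (fun i => 'I_(N i)) a) * (Q l a).@[lin M x v])).
    rewrite (sig_big_dep (fun=> true) (fun _ _ => true)
      (fun i a => c (Tagged (fun i => 'I_(N i)) a) * (Q i a).@[lin M x v])) /=.
    by apply: eq_bigr => -[].
  by move=> l _; rewrite raddf_sum; apply: eq_bigr => a _; rewrite /= mevalZ.
- rewrite raddf_sum (bigD1 j) //= pihomog_dE // big1 ?addr0 // => l lj.
  have [->|ql] := eqVneq (q l) 0; first by rewrite pihomog0.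
  apply: pihomog_ne0 (hq l); apply: contra lj => /eqP E; apply/eqP/val_inj => /=.
  by rewrite -(subKn (jrs l)) E subKn.
- move=> m /msupp_sum_le /flatten_mapP[l _ ml].
  have ql : q l != 0 by apply: contraTneq ml => ->; rewrite msupp0.
  have := dhomog_mf (hq l) ml; rewrite /= => ->.
  by rewrite leq_sub2l ?jmax //= subnK // leq_subr.
Qed.

Lemma bounded_separator Z d p (M : 'M[K]_(D, d.+1)) x N Delta :
  (0 < d)%N -> affine_variety Z -> hilbert_growth Z d p ->
  d`!%:R * lead_coef p <= Delta%:R -> finite_over Z M x N ->
  exists w : {mpoly K[d.+1]},
    [/\ forall v, Z v -> w.@[lin M x v] = 0, w.@[fun=> 0] = 1
      & (msize w <= Delta.+1)%N].
Proof.
move=> d0 Zvar growth deg fin.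
have [G G0 GZ] := finite_over_unit_equation fin.
have [|||w vw [w0 sw]] :=
    @vanish_bounded K d.+1 _ Z (lin M x) _ _ G Delta GZ G0 _; last by exists w.
- by move=> t Q; exact: (homog_not_vanishing d0 growth fin).
- move=> P Q PQ; have [L EL] := lin_mpoly M x.
  have [v Zv||] := @variety_prime Z (L P) (L Q) Zvar.
  + by rewrite -rmorphM EL PQ.
  + by move=> h; left => v /h; rewrite EL.
  + by move=> h; right => v /h; rewrite EL.
- by move=> r; exact: (width_le_degree growth deg).
Qed.

End Separator.

(** * Sampling in bipartite graphs *)

Section Combinatorics.
Local Open Scope nat_scope.

(** In terms of sampling, [w] uniform draws miss a set of size [a] with probability at most 1/2. The
    proof keeps two terms of the expansion of [(a + b) ^ w]. *)
Lemma leq_two_expn_sub n a w : a <= n -> n <= a * w -> 0 < w ->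
  n ^ w <= 2 * (n ^ w - (n - a) ^ w).
Proof.
move=> an naw w0; have [b Eb] : exists b, n = a + b by exists (n - a); rewrite subnKC.
have key : a * w * b ^ w.-1 + b ^ w <= n ^ w.
  rewrite {}Eb in an naw *; case: w naw w0 => // w _ _ /=; elim: w => [|w IH].
    by rewrite muln1 expn0 muln1 !expn1.
  rewrite [X in _ <= X]expnS; apply: leq_trans (leq_mul (leqnn (a + b)) IH).
  have -> : a * w.+2 * b ^ w.+1 + b ^ w.+2 =
      a * b ^ w.+1 + b * (a * w.+1 * b ^ w + b ^ w.+1).
    by rewrite mulnDr -expnS addnA mulnCA -expnS -mulnDl -mulnS.
  by rewrite mulnDl leq_add2r leq_mul // leq_addl.
have bE : n - a = b by rewrite Eb addKn.
have le2 : 2 * b ^ w <= n ^ w.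
  apply: leq_trans key; rewrite mul2n -addnn leq_add2r.
  rewrite -{1}(prednK w0) expnS leq_mul // (leq_trans _ naw) //.
  by rewrite Eb leq_addl.
rewrite bE mulnBr leq_subRL; last by rewrite leq_mul2l leq_exp2r // Eb leq_addl.
by rewrite [X in _ <= X]mul2n -addnn leq_add2r.
Qed.

Section Sampling.
Variables (I X : finType) (inc : X -> I -> bool) (s a w : nat).

Let N x := [set i | inc x i].

Lemma disjoint_pieces x : s * a <= #|N x| ->
  exists P : 'I_s -> {set I},
    [/\ forall j, P j \subset N x, forall j, #|P j| = a
      & forall j l, j != l -> [disjoint P j & P l]].
Proof.
move=> le; pose e := enum (N x); have ue : uniq e by exact: enum_uniq.
have se : size e = #|N x| by rewrite cardE.
pose P (j : 'I_s) := [set i in take a (drop (j * a) e)].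
have bound (j : 'I_s) : j * a + a <= size e.
  by rewrite se addnC -mulSn (leq_trans _ le) // leq_mul2r ltn_ord orbT.
have inP j i : i \in P j -> i \in e /\ j * a <= index i e < j * a + a.
  rewrite inE => /(nthP i)[t]; rewrite size_takel; last first.
    by rewrite size_drop leq_subRL (leq_trans _ (bound j)) ?leq_addr // addnC.
  move=> ta; rewrite nth_take // nth_drop => <-.
  have lt : j * a + t < size e by rewrite (leq_trans _ (bound j)) ?ltn_add2l.
  by rewrite mem_nth // index_uniq // leq_addr ltn_add2l.
exists P; split=> [j|j|j l].
- by apply/fintype.subsetP => i /inP[]; rewrite mem_enum.
- rewrite cardsE (card_uniqP _) ?take_uniq ?drop_uniq // size_takel //.
  by rewrite size_drop leq_subRL (leq_trans _ (bound j)) ?leq_addr // addnC.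
- move=> jl; rewrite -finset.setI_eq0; apply/eqP/finset.setP => i.
  rewrite finset.in_set0 finset.in_setI.
  apply/negP => /andP[/inP[_ /andP[j1 j2]] /inP[_ /andP[l1 l2]]].
  have half u v : u * a <= index i e -> index i e < v * a + a -> u <= v.
    move=> h1 h2; rewrite leqNgt; apply/negP => vu.
    have := leq_ltn_trans h1 h2; apply/negP; rewrite -leqNgt addnC -mulSn.
    by rewrite leq_mul2r vu orbT.
  by case/eqP: jl; apply/val_inj/anti_leq; rewrite (half j l) ?(half l j).
Qed.

(** There are [s] blocks of [w] draws with repetition; block [j] serves to hit the [j]-th of [s]
    disjoint pieces of a neighbourhood. *)
Definition sample := {ffun 'I_s -> {ffun 'I_w -> I}}.

Definition sampled (om : sample) : {set I} := [set om p.1 p.2 | p : 'I_s * 'I_w].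

Lemma card_sampled om : #|sampled om| <= s * w.
Proof.
by rewrite (leq_trans (leq_imset_card _ _)) // card_prod !card_ord.
Qed.

Lemma card_hitting (P : {set I}) : #|P| = a -> #|I| <= a * w -> 0 < w ->
  #|I| ^ w <= 2 * #|[set f : {ffun 'I_w -> I} | [exists t, f t \in P]]|.
Proof.
move=> cP Iaw w0; apply: leq_trans (leq_two_expn_sub _ Iaw w0) _.
  by rewrite -cP max_card.
rewrite leq_mul2l /=.
have <- : #|[set f : {ffun 'I_w -> I} | [exists t, f t \in P]]| =
  #|I| ^ w - (#|I| - a) ^ w; last by [].
have -> : [set f : {ffun 'I_w -> I} | [exists t, f t \in P]] =
    ~: [set f in ffun_on (mem (~: P))].
  apply/finset.setP => f; rewrite !inE; apply/existsP/idP => [[t ft]|].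
    by apply/negP => /ffun_onP /(_ t); rewrite !inE ft.
  move=> h; apply/existsP; apply: contraR h => /existsPn h.
  by apply/ffun_onP => t; rewrite !inE h.
by rewrite cardsCs finset.setCK cardsE card_ffun_on card_ffun card_ord -(cardsC P) cP addKn.
Qed.

(** Each block independently hits its own piece with probability at least 1/2; as the pieces are
    disjoint, success in all blocks gives [s] distinct sampled neighbours. *)
Lemma card_rich_samples x : s * a <= #|N x| -> #|I| <= a * w -> 0 < w ->
  (#|I| ^ w) ^ s <= 2 ^ s * #|[set om : sample | s <= #|N x :&: sampled om|]|.
Proof.
move=> le Iaw w0; have [P [PN cP dP]] := disjoint_pieces le.
pose H j := [set f : {ffun 'I_w -> I} | [exists t, f t \in P j]].
have HF : \prod_(j < s) #|H j| <= #|[set om : sample | s <= #|N x :&: sampled om|]|.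
  have -> : \prod_(j < s) #|H j| = #|family (fun j => mem (H j))|.
    by rewrite card_family foldrE big_map big_enum.
  rewrite -[X in X <= _]cardsE.
  apply: subset_leq_card; apply/fintype.subsetP => om; rewrite !inE => /familyP omH.
  have /fin_all_exists[t Ht] : forall j, exists t, om j t \in P j.
    by move=> j; have := omH j; rewrite inE => /existsP.
  pose g j := om j (t j).
  have gi : injective g.
    move=> j l Eg; apply/eqP; apply: contraT => /dP.
    rewrite -finset.setI_eq0 => /eqP/finset.setP/(_ (g j)).
    by rewrite !inE {1}/g Ht Eg /g Ht.
  rewrite -[X in X <= _]card_ord -(card_codom gi) -cardsE subset_leq_card //.
  apply/fintype.subsetP => i; rewrite inE => /codomP[j ->].
  rewrite finset.in_setI (fintype.subsetP (PN j)) ?Ht //=.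
  by apply/imsetP; exists (j, t j).
apply: leq_trans (leq_mul (leqnn _) HF).
rewrite -[X in 2 ^ X]card_ord -[X in _ ^ X <= _]card_ord -!prod_nat_const -big_split.
by apply: leq_prod => j _; exact: card_hitting.
Qed.

Variable pi : nat -> nat.
Hypothesis patterns : forall (S : {set I}) z, #|S| <= z ->
  #|[set N x :&: S | x : X]| <= pi z.
Hypothesis Kss_free : forall Y : {set X}, #|Y| = s ->
  #|[set i | [forall x in Y, inc x i]]| < s.
Hypothesis s_gt0 : 0 < s.

(** Rich points with the same trace on the sample share at least [s] neighbours, so [s] of them
    would violate [Kss_free]; there are at most [pi (s * w)] traces. *)
Lemma card_rich_points om : #|[set x | s <= #|N x :&: sampled om|]| <= s * pi (s * w).
Proof.
set R := [set x | _]; pose f x := N x :&: sampled om.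
apply: leq_trans (leq_mul (leqnn s) (patterns (card_sampled om))).
apply: (@leq_trans (s * #|f @: R|)); last first.
  rewrite leq_mul2l subset_leq_card ?orbT //.
  by apply/fintype.subsetP => S /imsetP[x _ ->]; apply/imsetP; exists x.
rewrite -[X in X <= _]sum1_card (partition_big_imset f) /= mulnC -sum_nat_const.
apply: leq_sum => S /imsetP[x0]; rewrite inE => sx0 ES.
rewrite sum1_card; apply: contraT; rewrite -ltnNge => /ltnW/card_geqP[t [ut st tR]].
have tS x : x \in t -> S = f x by move=> /tR /andP[_ /eqP ->].
have := @Kss_free [set x in t]; rewrite cardsE (card_uniqP ut) st => /(_ erefl).
rewrite ltnNge (leq_trans sx0) // -/(f x0) -ES subset_leq_card //.
apply/fintype.subsetP => i iS; rewrite inE; apply/forallP => x; apply/implyP; rewrite inE => /tS E.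
by move: iS; rewrite E !inE => /andP[].
Qed.

(** Double counting of the pairs of a point of [A] and a sample rich for it, by [card_rich_samples]
    and [card_rich_points]. *)
Lemma card_high_degree (A : {set X}) :
  0 < a -> #|I| <= a * w -> (forall x, x \in A -> s * a <= #|N x|) ->
  #|A| <= 2 ^ s * (s * pi (s * w)).
Proof.
move=> a0 Iaw deg; have [->|[x0 x0A]] := set_0Vmem A; first by rewrite cards0.
have I0 : 0 < #|I|.
  by rewrite (leq_trans _ (leq_trans (deg _ x0A) (max_card _))) // muln_gt0 s_gt0.
have w0 : 0 < w by move: (leq_trans I0 Iaw); rewrite muln_gt0 => /andP[].
have cS : #|{: sample}| = (#|I| ^ w) ^ s by rewrite !card_ffun !card_ord.
have S0 : 0 < (#|I| ^ w) ^ s by rewrite !expn_gt0 I0.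
rewrite -(leq_pmul2l S0) mulnCA.
pose rich x om := s <= #|N x :&: sampled om|.
apply: (@leq_trans (2 ^ s * \sum_(x in A) #|[set om | rich x om]|)).
  rewrite big_distrr /= mulnC -sum_nat_const; apply: leq_sum => x xA.
  exact: card_rich_samples (deg _ xA) Iaw w0.
rewrite leq_mul2l; apply/orP; right.
under eq_bigr do rewrite -sum1_card big_mkcond.
rewrite exchange_big /= -cS -sum_nat_const; apply: leq_sum => om _.
apply: leq_trans (card_rich_points om).
rewrite -big_mkcondr sum1_card subset_leq_card //.
by apply/fintype.subsetP => x /andP[_]; rewrite !inE.
Qed.

End Sampling.

End Combinatorics.

(** * Zero patterns and low degrees *)

Section Patterns.
Variables (K : fieldType) (k t : nat) (I X : finType) (inc : X -> I -> bool).
Variables (y : X -> 'rV[K]_k) (h : X -> I -> 'rV[K]_k -> K).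
Hypothesis polfun_h : forall x i, ~~ inc x i -> polfun t (h x i).
Hypothesis h_neq0 : forall x i, ~~ inc x i -> h x i (y x) != 0.
Hypothesis h_eq0 : forall x i x', ~~ inc x i -> inc x' i -> h x i (y x') = 0.

(* For each pattern [A] on [S], the product [g A] is nonzero at a point with
   pattern [A] and vanishes at the points whose pattern is not contained in [A];
   so these products are linearly independent. *)
Lemma card_patterns (S : {set I}) z : (#|S| <= z)%N ->
  (#|[set [set i | inc x i] :&: S | x : X]| <= (t * z + k) ^ k)%N.
Proof.
move=> Sz; set Ps := [set _ | x : X].
have /choice[rep repE] : forall A : {A | A \in Ps}, exists x,
    val A = [set i | inc x i] :&: S.
  by move=> A; have /imsetP[x _ E] := valP A; exists x.
pose g A v := \prod_i (if (i \in S) && ~~ inc (rep A) i then h (rep A) i v else 1).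
have hg A : polfun (t * z) (g A).
  apply: (@polfun_leq _ _ (\sum_i (if i \in S then t else 0))%N).
    by rewrite -big_mkcond sum_nat_const mulnC leq_mul2l Sz orbT.
  apply: polfun_prod => i; case: (i \in S) => /=; last exact: polfunC.
  have [ni|_] := boolP (~~ inc (rep A) i); last exact: polfunC.
  exact: polfun_h.
have [Q [_ _ Qspan]] := homog_basis K k (t * z).
have le : (#|{: {A | A \in Ps}}| <= 'C(t * z + k, t * z))%N.
  rewrite -[leqRHS]card_ord.
  apply: (@card_le_of_span K _ (fun _ => True) _ _ g
    (fun i v => peval (Q i) (homogenize_point v))).
    move=> A; have [q hq Eq] := hg A; have [c Ec] := Qspan _ hq; exists c => v _.
    by rewrite Eq Ec /peval raddf_sum; apply: eq_bigr => i _; rewrite /= mevalZ.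
  move=> c Hc A; apply/eqP; apply: contraT => cA.
  (* At a point with a largest pattern [B] of nonzero coefficient all other terms vanish: a
     different pattern containing [B] is larger and has coefficient 0, and any other misses an
     element of [B], where its product vanishes. *)
  have [B cB Bmax] : exists2 B, c B != 0 &
      forall B', c B' != 0 -> (#|val B'| <= #|val B|)%N.
    by case: (@arg_maxnP _ A (fun B => c B != 0) (fun B => #|val B|) cA) => B; exists B.
  case/eqP: cB; have := Hc (y (rep B)) Logic.I; rewrite (bigD1 B) //= big1 ?addr0.
    move=> /eqP; rewrite mulf_eq0 => /orP[/eqP //|]; rewrite prodf_seq_eq0.
    by move=> /hasP[i _] /=; case: ifP => [/andP[_ /h_neq0/negPf->]|_]; rewrite ?oner_eq0.
  move=> B' B'B; have [->|cB'] := eqVneq (c B') 0; first by rewrite mul0r.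
  have [sub|/subsetPn[i]] := boolP (val B \subset val B').
    case/eqP: B'B; apply: val_inj; apply/esym/eqP.
    by rewrite eqEcard sub Bmax.
  rewrite !repE !inE => /andP[iB iS]; rewrite iS andbT => iB'.
  rewrite /g (bigD1 i) //= iS iB' /= h_eq0 ?mul0r ?mulr0 //.
rewrite card_sig in le; rewrite -[leqLHS](eq_card (A := [pred A in Ps])) //.
rewrite (leq_trans le) //; have /andP[_ up] := bin_fact_bounds (t * z) k.
by rewrite (leq_trans _ up) // leq_pmulr ?fact_gt0.
Qed.

End Patterns.

Section LowDegree.
Variables (I X : finType) (inc : X -> I -> bool) (s t k : nat).
Let N x := [set i | inc x i].
Hypothesis patterns : forall (S : {set I}) z, (#|S| <= z)%N ->
  (#|[set N x :&: S | x : X]| <= (t * z + k) ^ k)%N.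
Hypothesis Kss_free : forall Y : {set X}, #|Y| = s ->
  (#|[set i | [forall x in Y, inc x i]]| < s)%N.
Hypotheses (s_gt0 : (0 < s)%N) (k_gt0 : (0 < k)%N).

(** The factor [2 ^ s * s] comes from [card_high_degree]; the other, times [#|I|], bounds the degree
    multiplied by [t * (s * w) + k]. *)
Definition degree_const := (2 ^ s * s * (4 * s * (t * s + k)))%N.

(** With [x] of least degree in [A], every point of [A] has at least that degree, so
    [card_high_degree] bounds [#|A|] in terms of it. *)
Lemma exists_low_degree (A : {set X}) : (0 < #|A|)%N ->
  exists2 x, x \in A & (#|N x| < s)%N \/
    (#|N x| ^ k * #|A| <= (degree_const * #|I|) ^ k)%N.
Proof.
move=> /card_gt0P[x0 x0A].
have [x xA xmin] : exists2 x, x \in A & forall x', x' \in A -> (#|N x| <= #|N x'|)%N.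
  by case: (@arg_minnP _ x0 (mem A) (fun x => #|N x|) x0A) => x; exists x.
exists x => //; have [|sd] := ltnP; [by left|right].
set dl := #|N x| in sd xmin *; set n := #|I|.
have dn : (dl <= n)%N by exact: max_card.
(* The largest size for which [s] disjoint pieces fit into [dl] elements. One draw more than
   [n %/ a] ensures [n <= a * w], and still [a * w <= 2 * n]. *)
pose a := (dl %/ s)%N; have a0 : (0 < a)%N by rewrite divn_gt0.
have sa : (s * a <= dl)%N by rewrite mulnC leq_divM.
pose w := (n %/ a).+1.
have naw : (n <= a * w)%N by rewrite mulnC ltnW // ltn_ceil.
have awn : (a * w <= 2 * n)%N.
  rewrite mulnS mul2n -addnn leq_add //; last by rewrite mulnC leq_divM.
  by rewrite (leq_trans _ dn) // (leq_trans _ sa) // leq_pmull.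
have cA := @card_high_degree _ _ inc s a w (fun z => (t * z + k) ^ k)%N patterns
  Kss_free s_gt0 A a0 naw (fun x' x'A => leq_trans sa (xmin x' x'A)).
have dl2 : (dl <= 2 * s * a)%N.
  rewrite (leq_trans (ltnW (ltn_ceil dl s_gt0))) // -/a mulnC -mulnA mulnCA.
  by rewrite leq_mul2l mul2n -addnn -addn1 leq_add2l a0 orbT.
have dlw : (dl * w <= 4 * s * n)%N.
  rewrite (leq_trans (leq_mul dl2 (leqnn w))) // -mulnA.
  by rewrite (leq_trans (leq_mul (leqnn _) awn)) // mulnA [(2 * s * 2)%N]mulnAC.
have dlt : (dl * (t * (s * w) + k) <= 4 * s * (t * s + k) * n)%N.
  rewrite [leqRHS]mulnAC (leq_trans _ (leq_mul dlw (leqnn _))) // -mulnA.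
  by rewrite leq_mul2l mulnDr mulnA [(w * _)%N]mulnC leq_add2l leq_pmull ?orbT.
apply: leq_trans (leq_mul (leqnn _) cA) _.
rewrite [X in (X <= _)%N](_ : _ = (2 ^ s * s) * (dl * (t * (s * w) + k)) ^ k)%N; last first.
  by rewrite expnMn !mulnA; congr (_ * _)%N; rewrite -[LHS]mulnA mulnC.
have -> : (degree_const * n = 2 ^ s * s * (4 * s * (t * s + k) * n))%N.
  by rewrite [RHS]mulnA.
(* Being at least 1, the factor [2 ^ s * s] may be moved inside the [k]-th power. *)
rewrite [leqRHS]expnMn leq_mul ?leq_exp2r //.
by rewrite -[leqLHS]expn1 leq_pexp2l // muln_gt0 expn_gt0 s_gt0.
Qed.

(* Removing a point of low degree; [step] telescopes the sum of [j^(-1/k)]. *)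
Lemma sum_degrees_le (R : realType) d (A : {set X}) : k = d.+1 -> (0 < d)%N ->
  (\sum_(x in A) #|N x|)%:R <=
  s%:R * #|A|%:R + 2 * (degree_const * #|I|)%:R * (#|A|%:R `^ k%:R^-1) ^+ d :> R.
Proof.
move=> kd d0; have [m cA] : exists m, #|A| = m by exists #|A|.
set C := (degree_const * #|I|)%N.
elim: m A cA => [|m IH] A cA.
  move/eqP: cA; rewrite cards_eq0 => /eqP ->; rewrite big_set0 cards0.
  by rewrite mulr0 add0r mulr_ge0 ?exprn_ge0 ?powR_ge0 ?mulr_ge0 ?ler0n.
have [|x xA low] := @exists_low_degree A; first by rewrite cA.
rewrite (big_setD1 x) //= natrD.
have cA' : #|A :\ x| = m by apply/eqP; rewrite -eqSS -cA (cardsD1 x A) xA.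
have {}IH := IH _ cA'; rewrite cA' in IH; rewrite cA.
set b := (m%:R `^ _) in IH; set a := (_ `^ _).
have rootE (j : nat) : (j%:R `^ k%:R^-1 : R) ^+ k = j%:R.
  by rewrite -powR_mulrn ?powR_ge0 // -powRrM mulVf ?powRr1 // kd pnatr_eq0.
have ak : a ^+ k = m.+1%:R by exact: rootE.
have bk : b ^+ k = m%:R by exact: rootE.
have b0 : 0 <= b by exact: powR_ge0.
have a0 : 0 < a by apply: powR_gt0; rewrite ltr0n.
have ba : b <= a.
  by rewrite -(@ler_pXn2r _ k) ?nnegrE ?(ltW a0) // ak bk ler_nat.
have step : 1 <= 2 * a * (a ^+ d - b ^+ d).
  have : a ^+ k - b ^+ k = 1 by rewrite ak bk -natrB // subSnn.
  rewrite kd => {1}<-; rewrite -subr_ge0.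
  case: d {kd IH} d0 => // d _.
  (* The right side is nonnegative because [0 <= b <= a]. *)
  have E : 2 * a * (a ^+ d.+1 - b ^+ d.+1) - (a ^+ d.+2 - b ^+ d.+2) =
    a ^+ 2 * (a ^+ d - b ^+ d) + b ^+ d * (a - b) ^+ 2.
    pose P := a * (a * a ^+ d); pose Q := a * (b * b ^+ d).
    pose S := b * (b * b ^+ d); pose T := a * (a * b ^+ d).
    have -> : 2 * a * (a ^+ d.+1 - b ^+ d.+1) = 2 * (P - Q).
      by rewrite -mulrA mulrBr !exprS.
    have -> : a ^+ d.+2 - b ^+ d.+2 = P - S by rewrite !exprS.
    have -> : a ^+ 2 * (a ^+ d - b ^+ d) = P - T by rewrite expr2 -mulrA !mulrBr.
    have -> : b ^+ d * (a - b) ^+ 2 = T - Q *+ 2 + S.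
      by rewrite sqrrB mulrDr mulrBr mulrnAr !expr2 ![b ^+ d * _]mulrC -!mulrA.
    rewrite mulr_natl mulrnBl opprB [RHS]addrA [P - T + _]addrA subrK.
    by rewrite mulr2n -!addrA; congr (_ + _); rewrite [S - P]addrC addrCA addNKr.
  rewrite E addr_ge0 ?mulr_ge0 ?exprn_ge0 ?subr_ge0 ?(ltW a0) //.
  by rewrite lerXn2r ?nnegrE ?(ltW a0).
have dx : #|N x|%:R <= s%:R + 2 * C%:R * (a ^+ d - b ^+ d) :> R.
  case: low => [lt|le].
    rewrite (le_trans (_ : _ <= s%:R)) ?ler_nat ?(ltnW lt) // lerDl.
    rewrite mulr_ge0 ?mulr_ge0 // subr_ge0 lerXn2r ?nnegrE ?(ltW a0) //.
  (* Taking [k]-th roots gives [#|N x| <= C / a], and [step] bounds [1 / a] by twice the increment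
     of [j ^ (d / k)]. *)
  have le1 : #|N x|%:R * a <= C%:R :> R.
    rewrite -(@ler_pXn2r _ k) ?nnegrE ?mulr_ge0 ?(ltW a0) //.
    by rewrite exprMn ak -cA -!natrX -natrM ler_nat.
  rewrite -[leLHS]addr0 [leRHS]addrC lerD //.
  rewrite -[leLHS]mulr1 (le_trans (ler_wpM2l _ step)) //.
  have -> : #|N x|%:R * (2 * a * (a ^+ d - b ^+ d)) =
      2 * (#|N x|%:R * a) * (a ^+ d - b ^+ d) :> R by rewrite !mulrA [_ * 2]mulrC.
  apply: ler_wpM2r; first by rewrite subr_ge0 lerXn2r ?nnegrE ?(ltW a0).
  by apply: ler_wpM2l.
apply: le_trans (lerD dx IH) _.
by rewrite addrACA -mulrDr subrK lerD // -natr1 mulrDr mulr1 addrC.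
Qed.

End LowDegree.

(** * Incidences *)

Lemma common_separators (K : closedFieldType) D d Delta (J : finType)
    (Zs : J -> set 'rV[K]_D) (xs : J -> 'rV[K]_D) : (0 < d)%N ->
  (forall j, [/\ affine_variety (Zs j), variety_dim (Zs j) = d
               & variety_degree (Zs j) <= Delta%:R]) ->
  (forall j, ~ Zs j (xs j)) ->
  exists M : 'M[K]_(D, d.+1), forall j, exists w : {mpoly K[d.+1]},
    [/\ forall v, Zs j v -> w.@[lin M (xs j) v] = 0, w.@[fun=> 0] = 1
      & (msize w <= Delta.+1)%N].
Proof.
move=> d0 HZ out.
have growth j : exists p, hilbert_growth (Zs j) d p /\
    d`!%:R * lead_coef p <= Delta%:R.
  have [_ dimZ degZ] := HZ j.
  have [|p [t0 [sp lp Hp]]] := @hilbert_polynomialP K D (Zs j); first by rewrite dimZ.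
  rewrite dimZ in sp lp; exists p; split; last by rewrite lp.
  by split=> //; exists t0.
have [|j|M fin] := @common_projection K D J Zs xs d _ _ out.
- by move=> j; have [p []] := growth j; exists p.
- by case: (HZ j) => -[].
exists M => j; have [N finN] := fin j; have [p [gp degp]] := growth j.
by case: (HZ j) => var _ _; exact: (bounded_separator d0 var gp degp finN).
Qed.

Lemma inl_inj (A B : Type) : injective (@inl A B).
Proof. by move=> x y []. Qed.

Lemma inr_inj (A B : Type) : injective (@inr A B).
Proof. by move=> x y []. Qed.

(** Edges are unordered pairs, so each is the image of an incident pair of a point and a variety. *)
Lemma incidences_le (F K : fieldType) (iota : {rmorphism F -> K}) D
    (P : {fset 'rV[F]_D}) (V : {fset set 'rV[K]_D}) :
  (incidences iota P V <=
   \sum_(x : P) #|[set Z : V | incidence_graph iota P V (inl x) (inr Z)]|)%N.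
Proof.
pose inc (x : P) (Z : V) := incidence_graph iota P V (inl x) (inr Z).
pose f (q : P * V) : {set P + V} := [set inl q.1; inr q.2].
apply: (@leq_trans #|f @: [set q | inc q.1 q.2]|).
  apply: subset_leq_card; apply/fintype.subsetP => E /imset2P[u v _].
  rewrite inE => /andP[_ uv] ->; case: u v uv => [x|Z] [x'|Z'] // uv.
    by apply/imsetP; exists (x, Z') => //; rewrite inE.
  by apply/imsetP; exists (x', Z); [rewrite inE|exact: finset.setUC].
rewrite (leq_trans (leq_imset_card _ _)) // -sum1_card.
rewrite (eq_bigl (fun q => true && inc q.1 q.2)); last by move=> q; rewrite inE.
rewrite -(pair_big_dep xpredT inc (fun _ _ => 1%N)) /=; apply: leq_sum => x _.
by rewrite sum1dep_card.
Qed.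

Theorem theorem1p1 (R : realType) (d Delta s : nat)
    (hd : (0 < d)%N) (hDelta : (0 < Delta)%N) (hs : (0 < s)%N) :
  exists C : R,
    forall (F : fieldType) (Fbar : closedFieldType)
      (iota : {rmorphism F -> Fbar}) (D m n : nat)
      (P : {fset 'rV[F]_D}) (V : {fset (set 'rV[Fbar]_D)}),
    is_algebraic_closure iota ->
    (0 < D)%N ->
    #|` P| = m ->
    #|` V| = n ->
    (forall Z : set 'rV[Fbar]_D, Z \in V ->
       [/\ affine_variety Z, variety_dim Z = d
         & variety_degree Z <= Delta%:R]) ->
    ~ contains_copy (complete_bipartite s s) (incidence_graph iota P V) ->
    (incidences iota P V)%:R
      <= C * (m%:R `^ (d%:R / (d + 1)%:R) * n%:R + m%:R).
Proof.
pose c := degree_const s Delta d.+1.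
exists (s%:R + 2 * c%:R) => F K iota D m n P V _ _ Pm Vn HV Kss.
pose X : finType := P; pose I : finType := V.
pose pt (x : X) : 'rV[K]_D := map_mx iota (fsval x).
pose inc (x : X) (Z : I) : bool := pt x \in (fsval Z : set 'rV[K]_D).
pose J := {q : X * I | ~~ inc q.1 q.2}.
have [||M HM] := @common_separators K D d Delta J
  (fun j => fsval (val j).2) (fun j => pt (val j).1) hd.
- by move=> j; apply: HV; exact: fsvalP.
- by move=> [[x Z] /= /negP xZ] Zx; apply: xZ; rewrite /inc inE.
have /choice[w Hw] : forall q : X * I, exists w : {mpoly K[d.+1]}, ~~ inc q.1 q.2 ->
    [/\ forall v, (fsval q.2 : set _) v -> w.@[lin M (pt q.1) v] = 0, w.@[fun=> 0] = 1
      & (msize w <= Delta.+1)%N].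
  move=> q; case: (boolP (inc q.1 q.2)) => [_|nq]; first by exists 0.
  by have [w ?] := HM (exist _ q nq); exists w.
(* The points are projected to dimension [d + 1], where the separators become functions of degree at
   most [Delta]; this removes [D] from the count of patterns. *)
pose y x := pt x *m M.
pose h x Z v := (w (x, Z)).@[lin 1%:M (y x) v].
have hE x Z x' : h x Z (y x') = (w (x, Z)).@[lin M (pt x) (pt x')].
  by apply: meval_eq => j; rewrite /lin mulmx1 mulmxBl.
have patterns (S : {set I}) z : (#|S| <= z)%N ->
    (#|[set [set i | inc x i] :&: S | x : X]| <= (Delta * z + d.+1) ^ d.+1)%N.
  apply: (@card_patterns K d.+1 Delta I X inc y h) => [x Z xZ|x Z xZ|x Z x' xZ x'Z].
  - have [_ _ sw] := Hw (x, Z) xZ.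
    apply: polfun_msum => [j|b /msize_mdeg_lt /leq_trans]; first exact: polfun_lin.
    by move=> /(_ _ sw).
  - have [_ w1 _] := Hw (x, Z) xZ; rewrite hE.
    rewrite (meval_eq (v2 := fun=> 0)) ?w1 ?oner_eq0 // => j.
    by rewrite /lin subrr mul0mx mxE.
  - have [w0 _ _] := Hw (x, Z) xZ; rewrite hE w0 //.
    by move: x'Z; rewrite /inc inE.
have Kss_free (Y : {set X}) : #|Y| = s ->
    (#|[set i | [forall x in Y, inc x i]]| < s)%N.
  move=> cY; rewrite ltnNge; apply/negP => sB; apply: Kss.
  set B := [set i | _] in sB.
  have [t [ut st tB]] := card_geqP sB.
  have sY : size (enum Y) == s by rewrite -cardE cY.
  pose ty := Tuple sY; pose tt := Tuple (introT eqP st).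
  exists (fun u => match u with inl i => inl (tnth ty i) | inr i => inr (tnth tt i) end).
    have inj_ty : injective (tnth ty) by apply/tuple_uniqP; exact: enum_uniq.
    have inj_tt : injective (tnth tt) by apply/tuple_uniqP.
    move=> [i|i] [j|j] E; try discriminate E.
      by congr inl; apply: inj_ty; apply: inl_inj E.
    by congr inr; apply: inj_tt; apply: inr_inj E.
  have tytt i j : inc (tnth ty i) (tnth tt j).
    have := tB _ (mem_tnth j tt); rewrite inE => /forallP /(_ (tnth ty i)) /implyP; apply.
    by have := mem_tnth i ty; rewrite mem_enum.
  by move=> [i|i] [j|j] // _; exact: tytt.
have := @sum_degrees_le I X inc s Delta d.+1 patterns Kss_free hs (ltn0Sn d) R d
  [set: X] erefl hd.
have cX : #|[set: X]| = m by rewrite cardsT -Pm cardfE.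
have cI : #|I| = n by rewrite -Vn cardfE.
rewrite cX cI => le_sum.
have le_inc : (incidences iota P V)%:R <= (\sum_(x in [set: X]) #|[set i | inc x i]|)%:R :> R.
  rewrite ler_nat (leq_trans (incidences_le _ _ _)) //.
  by rewrite [leqRHS](eq_bigl xpredT) // => x; rewrite inE.
apply: le_trans le_inc (le_trans le_sum _).
have -> : m%:R `^ (d%:R / (d + 1)%:R) = (m%:R `^ (d.+1)%:R^-1) ^+ d :> R.
  by rewrite addn1 mulrC powRrM powR_mulrn // powR_ge0.
set a := _ ^+ d; have a0 : 0 <= a by rewrite exprn_ge0 ?powR_ge0.
rewrite -/c; clearbody c; rewrite natrM [leRHS]mulrDl lerD //.
  by rewrite ler_wpM2l // lerDr mulr_ge0.
by rewrite -!mulrA ler_wpM2l // ler_wpM2l // [_ * a]mulrC lerDl.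
Qed.
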